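(* Fix an integer $m\ge 1$. Let $\mathcal P$ be one of the following five sets of column-convex polygons (described via the step counts defined in the context): (i) Ferrers diagrams: $\overline S_i=0$ for all $i$ and $\underline N_i=\underline S_i=0$ for $0\le i\le m-1$; (ii) stacks: $\overline S_i=0$ for all $i$ and $\underline N_i=0$ for $0\le i\le m-1$; (iii) staircase polygons: $\overline S_i=\underline S_i=0$ for all $i$; (iv) bar-graphs: $\underline N_i=\underline S_i=0$ for $0\le i\le m-1$; (v) all column-convex polygons. Let $\mathcal P_m$ be the set of polygons of $\mathcal P$ of width $m$, and let $$F_m(\overline{\mathbf y},\overline{\mathbf z},\underline{\mathbf y},\underline{\mathbf z})=\sum_{P\in\mathcal P_m}\prod_{i=0}^{m}\overline y_i^{\,\overline N_i}\,\overline z_i^{\,\overline S_i}\,\underline y_i^{\,\underline N_i}\,\underline z_i^{\,\underline S_i}.$$ Then $F_m$ is a rational function and $$F_m(1/\overline{\mathbf y},1/\overline{\mathbf z},1/\underline{\mathbf y},1/\underline{\mathbf z})=C_m\,F_m(\overline{\mathbf y},\overline{\mathbf z},\underline{\mathbf y},\underline{\mathbf z}),$$ where $C_m=\dfrac{(-1)^m\underline y_m^{\,m-2}}{\overline y_0}\prod_{i=1}^{m-1}\overline y_i$ for Ferrers diagrams; $C_m=-\dfrac{\underline y_m^{\,2m-3}}{\overline y_0}\prod_{i=1}^{m-1}\overline y_i\underline z_i$ for stacks; $C_m=-\prod_{i=1}^{m-1}\underline y_i\overline y_i$ for staircase polygons (here assuming $m\ge2$); $C_m=\dfrac{(-1)^m}{\overline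 y_0\underline y_m}$ for bar-graphs; $C_m=-\dfrac{1}{\overline y_0\underline y_m}$ for column-convex polygons.
   Context: Work on the square lattice; polygons are considered up to translation. A self-avoiding polygon is column-convex if its intersection with every vertical line is connected (the boundary meets each vertical line in at most two connected components). A column-convex polygon of width $m$ occupies $m$ consecutive unit columns, between the vertical lines $x=0$ and $x=m$. Its boundary is split into two partially directed paths (using only north, south and east unit steps) with the same endpoints: the top path $\overline\gamma$, which goes up the left edge of the polygon and then along its top boundary to the upper-right corner of the last column, and the bottom path $\underline\gamma$, which goes along the bottom boundary from the lower-left corner of the first column and then up the right edge. For $0\le i\le m$, $\overline N_i$ (resp. $\overline S_i$) is the number of north (resp. south) steps of $\overline\gamma$ lying on the line $x=i$, and $\underline N_i$ (resp. $\underline S_i$) is the number of north (resp. south) steps of $\underline\gamma$ on the line $x=i$; with this convention $\underline N_0=\underline S_0=\overline N_m=\overline S_m=\overline S_0=\underline S_m=0$. The $\overline y_i,\overline z_i,\underline y_i,\underline z_i$ ($0\le i\le m$) are indeterminates, and $1/\overline{\mathbf y}$ etc. means each variable replaced by its reciprocal. *)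

(* Defs.v *)
From HB Require Import structures.
From mathcomp Require Import all_boot all_order all_algebra.
From mathcomp Require Import mpoly.

Set Implicit Arguments.
Unset Strict Implicit.
Unset Printing Implicit Defensive.

Import Order.TTheory GRing.Theory Num.Theory.
Local Open Scope ring_scope.

(* Column-convex polygons of width m, up to translation.                    *)
(* Column j (0 <= j < m) is the unit column between x = j and x = j+1; its  *)
(* cells occupy the vertical interval [b j, t j].  Translation is fixed by  *)
(* b 0 = 0.  Only the values b j, t j for j < m matter.                     *)

(* (b, t) describes a column-convex polygon of width m:                     *)
(*  - every column is non-empty (b j < t j),                                *)
(*  - consecutive columns share a vertical edge segment of positive length  *)
(*    (needed for the boundary to be a single self-avoiding polygon).       *)
Definition is_ccpoly (m : nat) (b t : nat -> int) : bool :=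
  [&& b 0%N == 0,
      [forall j : 'I_m, b j < t j] &
      [forall j : 'I_m, (j.+1 < m)%N ==> (b j.+1 < t j) && (b j < t j.+1)]].

Definition ppart (z : int) : nat := if 0 <= z then `|z|%N else 0%N.

(* Step counts on the vertical line x = i, 0 <= i <= m.                     *)
(* top path: up the left edge (line 0), then along the top boundary.        *)
Definition Ntop (m : nat) (b t : nat -> int) (i : nat) : nat :=
  if i == 0%N then `|t 0%N - b 0%N|%N
  else if (i < m)%N then ppart (t i - t i.-1) else 0%N.
Definition Stop (m : nat) (b t : nat -> int) (i : nat) : nat :=
  if (0 < i < m)%N then ppart (t i.-1 - t i) else 0%N.
(* bottom path: along the bottom boundary, then up the right edge (line m). *)
Definition Nbot (m : nat) (b t : nat -> int) (i : nat) : nat :=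
  if (0 < i < m)%N then ppart (b i - b i.-1)
  else if i == m then `|t m.-1 - b m.-1|%N else 0%N.
Definition Sbot (m : nat) (b t : nat -> int) (i : nat) : nat :=
  if (0 < i < m)%N then ppart (b i.-1 - b i) else 0%N.

Inductive pclass := Ferrers | Stack | Staircase | Bargraph | ColumnConvex.

Definition in_class (c : pclass) (m : nat) (b t : nat -> int) : bool :=
  let topN0 := [forall i : 'I_m.+1, Stop m b t i == 0%N] in
  let botN0 := [forall i : 'I_m, Nbot m b t i == 0%N] in
  let botS0 := [forall i : 'I_m, Sbot m b t i == 0%N] in
  match c with
  | Ferrers => [&& topN0, botN0 & botS0]
  | Stack => topN0 && botN0
  | Staircase => topN0 && [forall i : 'I_m.+1, Sbot m b t i == 0%N]
  | Bargraph => botN0 && botS0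
  | ColumnConvex => true
  end.

(* Variables.  There are 4(m+1) indeterminates, indexed by k : 'I_4 and     *)
(* i : 'I_(m+1):  k = 0 : ybar_i,  k = 1 : zbar_i,  k = 2 : yund_i,         *)
(* k = 3 : zund_i.  Variable (k,i) is 'X_(k*(m+1)+i).                       *)
Definition nvars (m : nat) : nat := (4 * m.+1)%N.

Lemma vid_proof (m : nat) (k : 'I_4) (i : 'I_m.+1) :
  (k * m.+1 + i < nvars m)%N.
Proof.
rewrite /nvars; have hk := ltn_ord k; have hi := ltn_ord i.
apply: (@leq_trans (k * m.+1 + m.+1)%N); first by rewrite ltn_add2l.
by rewrite -mulSnr leq_mul2r hk orbT.
Qed.

Definition vid (m : nat) (k : 'I_4) (i : 'I_m.+1) : 'I_(nvars m) :=
  Ordinal (vid_proof k i).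

Definition expo (m : nat) (b t : nat -> int) (j : nat) : nat :=
  let k := (j %/ m.+1)%N in let i := (j %% m.+1)%N in
  match k with
  | 0 => Ntop m b t i
  | 1 => Stop m b t i
  | 2 => Nbot m b t i
  | _ => Sbot m b t i
  end.

Definition weight (m : nat) (b t : nat -> int) : 'X_{1..nvars m} :=
  [multinom expo m b t j | j < nvars m].

(* The generating function F_m as a formal power series: its coefficient    *)
(* of the monomial e is the number of polygons of the class of width m      *)
(* whose weight is e.  Any such polygon satisfies |b j|, |t j| <= mdeg e    *)
(* (heights are sums of steps), so they are all counted inside the finite   *)
(* box of column data with coordinates in [-mdeg e, mdeg e].                *)
Definition box_decode (d : nat) (m : nat)
  (f : {ffun 'I_m -> 'I_(2 * d).+1 * 'I_(2 * d).+1}) : (nat -> int) * (nat -> int) :=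
  (fun j => oapp (fun jj : 'I_m => ((f jj).1 : int) - d%:Z) 0 (insub j),
   fun j => oapp (fun jj : 'I_m => ((f jj).2 : int) - d%:Z) 0 (insub j)).

Definition Fcoef (c : pclass) (m : nat) (e : 'X_{1..nvars m}) : nat :=
  let d := mdeg e in
  #|[pred f : {ffun 'I_m -> 'I_(2 * d).+1 * 'I_(2 * d).+1} |
      [&& is_ccpoly m (box_decode f).1 (box_decode f).2,
          in_class c m (box_decode f).1 (box_decode f).2 &
          weight m (box_decode f).1 (box_decode f).2 == e] ]|.

Definition series_mul_coef (n : nat) (Q : {mpoly rat[n]}) (F : 'X_{1..n} -> rat)
  (e : 'X_{1..n}) : rat :=
  \sum_(d <- msupp Q | (d <= e)%MM) Q@_d * F (e - d)%MM.

Definition ratfun (n : nat) := {fraction {mpoly rat[n]}}.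

Definition rvar (n : nat) (j : 'I_n) : ratfun n := tofrac ('X_j).

Definition rf (n : nat) (p : {mpoly rat[n]}) : ratfun n := tofrac p.

Definition rf_inv (n : nat) (p : {mpoly rat[n]}) : ratfun n :=
  mmap (fun c : rat => tofrac (c%:MP)) (fun j => (rvar j)^-1) p.

Definition ybar m (i : 'I_m.+1) : ratfun (nvars m) := rvar (vid (0 : 'I_4) i).
Definition zbar m (i : 'I_m.+1) : ratfun (nvars m) := rvar (vid (1 : 'I_4) i).
Definition yund m (i : 'I_m.+1) : ratfun (nvars m) := rvar (vid (2 : 'I_4) i).
Definition zund m (i : 'I_m.+1) : ratfun (nvars m) := rvar (vid (3 : 'I_4) i).

Definition Cfactor (c : pclass) (m : nat) : ratfun (nvars m) :=
  match c with
  | Ferrers => (-1) ^+ m * yund (ord_max : 'I_m.+1) ^ (m%:Z - 2)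
               / ybar (ord0 : 'I_m.+1)
               * \prod_(i < m.+1 | (0 < i < m)%N) ybar i
  | Stack => - (yund (ord_max : 'I_m.+1) ^ (2 * m%:Z - 3)
               / ybar (ord0 : 'I_m.+1)
               * \prod_(i < m.+1 | (0 < i < m)%N) (ybar i * zund i))
  | Staircase => - \prod_(i < m.+1 | (0 < i < m)%N) (yund i * ybar i)
  | Bargraph => (-1) ^+ m / (ybar (ord0 : 'I_m.+1) * yund (ord_max : 'I_m.+1))
  | ColumnConvex => - (1 / (ybar (ord0 : 'I_m.+1) * yund (ord_max : 'I_m.+1)))
  end.

(* Main.v *)
(* Stanley's reciprocity for P-partitions.  A polygon is an integer map [f] on
   the set of its column ends b_j, t_j, subject to inequalities f(p) <= f(q) or
   f(p) < f(q).  With a suitable labelling [om] of the ends these say that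
   (f(p), om p) < (f(q), om q) lexicographically, the strict ones being those
   along which the label decreases.  The weight is additive on the chambers of
   the braid arrangement, so peeling off the lexicographically least end w of an
   up-set U yields
     (1 - X_U) H_(U,l) = sum_w X_U^[om w < om l] H_(U - w, w),
   where X_U is the weight of the indicator of U.  Inverting the variables turns
   X^eps / (1 - X) into - X^(1 - eps) / (1 - X), which is the effect of reversing
   the labelling, up to the sign (-1)^|U|.  Finally, a fixed translation of each
   column end exchanges the strict and weak inequalities and multiplies every
   weight by the same monomial; this monomial and the sign make up C_m. *)
Require Import Defs.
From HB Require Import structures.
From mathcomp Require Import all_boot all_order all_algebra.
From mathcomp Require Import mpoly.
From mathcomp Require Import zify ring.
Import Order.TTheory GRing.Theory Num.Theory.
Local Open Scope ring_scope.

Set Implicit Arguments.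
Unset Strict Implicit.
Unset Printing Implicit Defensive.

(** * Rational power series and their reciprocals *)

(** The letters [p], [q], [r], [u] stand for [rf_inv P], [rf Q], [rf P'], [rf_inv Q]; the relation
    between them survives putting two fractions over a common denominator. *)
Lemma mediant_reciprocity (K : comRingType) (s p1 q1 r1 u1 p2 q2 r2 u2 : K) :
  p1 * q1 = s * r1 * u1 -> p2 * q2 = s * r2 * u2 ->
  (u2 * p1 + u1 * p2) * (q1 * q2) = s * (q2 * r1 + q1 * r2) * (u1 * u2).
Proof.
move=> h1 h2; transitivity (u2 * q2 * (p1 * q1) + u1 * q1 * (p2 * q2)).
  by ring.
by rewrite h1 h2; ring.
Qed.

(** Either the inverted series carries [x], which becomes [1/x], or the other one does and its [x]
    has to be divided out; both cases change the ratio by [1/x]. *)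
Lemma shift_reciprocity (K : fieldType) (s x p q r u : K) (b : bool) :
  x != 0 -> p * q = s * r * u ->
  (if b then x^-1 else 1) * p * q = s / x * ((if b then 1 else x) * r) * u.
Proof.
move=> x0 h; case: b.
  by rewrite -mulrA h; ring.
by rewrite mul1r h; field.
Qed.

(** This is [1/(1 - 1/x) = - x/(1 - x)] with denominators cleared. *)
Lemma geometric_reciprocity (K : fieldType) (s x p q r u : K) :
  x != 0 -> p * q = s * r * u ->
  p * ((1 - x) * q) = - (s * x) * r * ((1 - x^-1) * u).
Proof.
move=> x0 h; transitivity ((1 - x) * (p * q)); first by ring.
by rewrite h; field.
Qed.

Section RationalSeries.
Context {n : nat}.
Implicit Types (P Q p q : {mpoly rat[n]}) (F : 'X_{1..n} -> rat) (e a : 'X_{1..n}).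

Let rf_inv_morph : {rmorphism {mpoly rat[n]} -> ratfun n} :=
  mmap (@tofrac _ \o @mpolyC n rat) (fun j => (rvar j)^-1).

Lemma rf_invM p q : rf_inv (p * q) = rf_inv p * rf_inv q.
Proof. exact: (rmorphM rf_inv_morph). Qed.

Lemma rf_invD p q : rf_inv (p + q) = rf_inv p + rf_inv q.
Proof. exact: (rmorphD rf_inv_morph). Qed.

Lemma rf_invB p q : rf_inv (p - q) = rf_inv p - rf_inv q.
Proof. exact: (rmorphB rf_inv_morph). Qed.

Lemma rf_inv0 : rf_inv (0 : {mpoly rat[n]}) = 0.
Proof. exact: (rmorph0 rf_inv_morph). Qed.

Lemma rf_inv1 : rf_inv (1 : {mpoly rat[n]}) = 1.
Proof. exact: (rmorph1 rf_inv_morph). Qed.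

Lemma rfM p q : rf (p * q) = rf p * rf q.
Proof. exact: tofracM. Qed.

Lemma rfD p q : rf (p + q) = rf p + rf q.
Proof. exact: tofracD. Qed.

Lemma rfB p q : rf (p - q) = rf p - rf q.
Proof. exact: tofracB. Qed.

Lemma rf0 : rf (0 : {mpoly rat[n]}) = 0.
Proof. exact: tofrac0. Qed.

Lemma rf1 : rf (1 : {mpoly rat[n]}) = 1.
Proof. exact: tofrac1. Qed.

Lemma rf_neq0 p : (rf p != 0) = (p != 0).
Proof. by rewrite tofrac_eq0. Qed.

Lemma rf_monomE e : rf 'X_[e] = \prod_(i < n) rvar i ^+ e i.
Proof.
rewrite mpolyXE_id /rf rmorph_prod; apply: eq_bigr => i _.
by rewrite rmorphXn.
Qed.

Lemma mpolyX_neq0 e : 'X_[e] != 0 :> {mpoly rat[n]}.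
Proof.
by apply/eqP => /(congr1 (mcoeff e)) /eqP; rewrite mcoeffX eqxx mcoeff0 oner_eq0.
Qed.

Lemma rf_inv_monom e : rf_inv 'X_[e] = (rf 'X_[e])^-1.
Proof.
rewrite /rf_inv; have -> := mmapX (fun j => (rvar j)^-1) (@tofrac _ \o @mpolyC n rat) e.
rewrite rf_monomE /mmap1 -prodfV; apply: eq_bigr => i _.
by rewrite exprVn.
Qed.

Lemma rf_monomD x y : rf 'X_[x + y] = rf 'X_[x] * rf 'X_[y] :> ratfun n.
Proof. by rewrite mpolyXD rfM. Qed.

Lemma rf_monomMn x k : rf 'X_[x *+ k] = rf 'X_[x] ^+ k :> ratfun n.
Proof. by rewrite -mpolyXn; apply: tofracXn. Qed.

Lemma rf_monom0 : rf 'X_[0%MM] = 1 :> ratfun n.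
Proof. by rewrite mpolyX0 rf1. Qed.

Lemma rf_var (i : 'I_n) : rf 'X_[U_(i)] = rvar i. Proof. by []. Qed.

(** Power series are handled through polynomial truncations: an identity of series is tested modulo
    degree [N], for every [N]. *)
Definition eqtrunc (N : nat) p q := forall e, (mdeg e < N)%N -> p@_e = q@_e.

Lemma eqtruncMl N r p q : eqtrunc N p q -> eqtrunc N (r * p) (r * q).
Proof.
move=> E e he; rewrite !mcoeffM; apply: eq_bigr => k /eqP ek.
have := congr1 mdeg ek; rewrite mdegD => dk.
by rewrite E //; move: he dk; lia.
Qed.

Lemma eqtrunc_eq p q : (forall N, eqtrunc N p q) -> p = q.
Proof. by move=> E; apply/mpolyP => e; apply: (E (mdeg e).+1). Qed.

Definition trunc F N : {mpoly rat[n]} :=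
  \sum_(e : 'X_{1..n < N}) F e *: 'X_[e].

Lemma trunc_coef F N e : (mdeg e < N)%N -> (trunc F N)@_e = F e.
Proof. by move=> he; rewrite mcoeff_mpoly. Qed.

Lemma monomM_coef a p e : ('X_[a] * p)@_e = if (a <= e)%MM then p@_(e - a) else 0.
Proof.
case: ifP => ae; first by have := mcoeffMX p a (e - a)%MM; rewrite addmC submK // mulrC.
rewrite mcoeffM big1 // => k /eqP ek; rewrite mcoeffX.
case: eqP => [ak|_]; last by rewrite mul0r.
by move: ae; rewrite {1}ek -ak lem_addr.
Qed.

(** Only values of [F] at exponents dividing [e] enter, and these have degree less than [N]. *)
Lemma series_mul_coefE Q F N e : (mdeg e < N)%N ->
  series_mul_coef Q F e = (Q * trunc F N)@_e.
Proof.
move=> he; rewrite {2}(mpolyE Q) mulr_suml raddf_sum /series_mul_coef big_mkcond.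
apply: eq_bigr => d _ /=; rewrite -scalerAl mcoeffZ monomM_coef.
case: ifP => de; last by rewrite mulr0.
by rewrite trunc_coef // (leq_ltn_trans _ he) // -{2}(submK de) mdegD leq_addr.
Qed.

(* [F] and [F'] are rational, and substituting inverses in [F] gives [s F']. *)
Definition reciprocal (s : ratfun n) F F' :=
  exists P P' Q, [/\ Q@_0%MM != 0, rf_inv Q != 0,
    forall N, eqtrunc N (Q * trunc F N) P,
    forall N, eqtrunc N (Q * trunc F' N) P' &
    rf_inv P * rf Q = s * rf P' * rf_inv Q].

Lemma reciprocal_ext s F1 F1' F2 F2' :
  F1 =1 F2 -> F1' =1 F2' -> reciprocal s F1 F1' -> reciprocal s F2 F2'.
Proof.
move=> E E' [P [P' [Q [h1 h2 h3 h4 h5]]]]; exists P, P', Q; split=> // N.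
  have <-: trunc F1 N = trunc F2 N by apply: eq_bigr => e _; rewrite E.
  exact: h3.
have <-: trunc F1' N = trunc F2' N by apply: eq_bigr => e _; rewrite E'.
exact: h4.
Qed.

Lemma reciprocal0 s : reciprocal s (fun=> 0) (fun=> 0).
Proof.
have T N : trunc (fun=> 0) N = 0 by rewrite /trunc big1 // => i _; rewrite scale0r.
exists 0, 0, 1; split; rewrite ?rf_inv1 ?oner_eq0 // ?mcoeff1 ?eqxx ?oner_eq0 //.
- by move=> N; rewrite T mulr0.
- by move=> N; rewrite T mulr0.
- by rewrite rf_inv0 rf0 mulr0 !mul0r.
Qed.

Lemma reciprocalD s F F' G G' :
  reciprocal s F F' -> reciprocal s G G' ->
  reciprocal s (fun e => F e + G e) (fun e => F' e + G' e).
Proof.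
move=> [P1 [P1' [Q1 [a1 b1 c1 d1 e1]]]] [P2 [P2' [Q2 [a2 b2 c2 d2 e2]]]].
have T (A B : 'X_{1..n} -> rat) N :
    trunc (fun e => A e + B e) N = trunc A N + trunc B N.
  by rewrite /trunc -big_split; apply: eq_bigr => e _; rewrite scalerDl.
have gen (A B : 'X_{1..n} -> rat) R1 R2 :
    (forall N, eqtrunc N (Q1 * trunc A N) R1) ->
    (forall N, eqtrunc N (Q2 * trunc B N) R2) ->
    forall N, eqtrunc N (Q1 * Q2 * trunc (fun e => A e + B e) N) (Q2 * R1 + Q1 * R2).
  move=> hA hB N e he; rewrite T.
  rewrite mulrDr {1}[Q1 * Q2]mulrC -!mulrA.
  by rewrite !mcoeffD; congr (_ + _); apply: eqtruncMl he.
exists (Q2 * P1 + Q1 * P2), (Q2 * P1' + Q1 * P2'), (Q1 * Q2); split.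
- by rewrite rmorphM mulf_neq0.
- by rewrite rf_invM; exact: (mulf_neq0 b1 b2).
- exact: gen.
- exact: gen.
- rewrite rf_invD !rf_invM rfD !rfM.
  exact: mediant_reciprocity.
Qed.

Lemma reciprocal_sum (I : Type) (r : seq I) (A : pred I) s
    (F F' : I -> 'X_{1..n} -> rat) :
  (forall i, A i -> reciprocal s (F i) (F' i)) ->
  reciprocal s (fun e => \sum_(i <- r | A i) F i e)
               (fun e => \sum_(i <- r | A i) F' i e).
Proof.
move=> h; elim: r => [|i r IH].
  by apply: reciprocal_ext (reciprocal0 s) => e; rewrite big_nil.
case Ai: (A i).
  by apply: reciprocal_ext (reciprocalD (h i Ai) IH) => e; rewrite big_cons Ai.
by apply: reciprocal_ext IH => e; rewrite big_cons Ai.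
Qed.

Definition shift a F e := if (a <= e)%MM then F (e - a)%MM else 0.

Lemma trunc_shift a F N : eqtrunc N (trunc (shift a F) N) ('X_[a] * trunc F N).
Proof.
move=> e he; rewrite monomM_coef trunc_coef // /shift; case: ifP => // ae.
by rewrite trunc_coef // (leq_ltn_trans _ he) // -{2}(submK ae) mdegD leq_addr.
Qed.

Lemma shift_generated a F Q P :
  (forall N, eqtrunc N (Q * trunc F N) P) ->
  forall N, eqtrunc N (Q * trunc (shift a F) N) ('X_[a] * P).
Proof.
move=> h N e he; rewrite (eqtruncMl _ (@trunc_shift a F N)) // mulrCA.
by rewrite (eqtruncMl _ (h N)).
Qed.

Lemma rf_monom_neq0 a : rf 'X_[a] != 0 :> ratfun n.
Proof. by rewrite rf_neq0 mpolyX_neq0. Qed.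

Lemma reciprocal_shift a (b : bool) s F F' : reciprocal s F F' ->
  reciprocal (s / rf 'X_[a])
    (shift (if b then a else 0%MM) F) (shift (if b then 0%MM else a) F').
Proof.
move=> [P [P' [Q [h1 h2 h3 h4 h5]]]].
exists ('X_[if b then a else 0%MM] * P), ('X_[if b then 0%MM else a] * P'), Q.
split=> //; first exact: shift_generated.
  exact: shift_generated.
rewrite rf_invM rf_inv_monom rfM.
have := shift_reciprocity b (rf_monom_neq0 a) h5.
by case: b; rewrite mpolyX0 rf1 ?invr1.
Qed.

(** Both series solve an equation [F = X^a F + G], so both acquire the factor [1 - X^a] in the
    denominator; [a != 0] keeps the constant term of the denominator nonzero. *)
Lemma reciprocal_geom a s F F' G G' : a != 0%MM -> reciprocal s G G' ->
  (forall e, F e = shift a F e + G e) ->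
  (forall e, F' e = shift a F' e + G' e) ->
  reciprocal (- (s * rf 'X_[a])) F F'.
Proof.
move=> a0 [P [P' [Q [h1 h2 h3 h4 h5]]]] hF hF'.
have T A B R : (forall e, A e = shift a A e + B e) ->
    (forall N, eqtrunc N (Q * trunc B N) R) ->
    forall N, eqtrunc N ((1 - 'X_[a]) * Q * trunc A N) R.
  move=> hA hB N e he; rewrite mulrC [_ * Q]mulrC mulrCA mulrBr mulr1.
  rewrite -(hB N) //; apply: eqtruncMl he => d hd.
  rewrite mulrC mcoeffB -(trunc_shift a A hd) !trunc_coef // hA.
  by rewrite addrAC subrr add0r.
exists P, P', ((1 - 'X_[a]) * Q); split.
- rewrite rmorphM rmorphB rmorph1 /= mcoeffX (negPf a0) subr0 mul1r.
  exact: h1.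
- rewrite rf_invM rf_invB rf_inv1 rf_inv_monom; apply: (mulf_neq0 _ h2).
  (* [1 - 1/X^a] vanishes only if [1 - X^a] does, and the latter has constant coefficient 1. *)
  rewrite subr_eq0 eq_sym invr_eq1 eq_sym -subr_eq0 -rf1 -rfB.
  rewrite rf_neq0; apply/eqP => /(congr1 (mcoeff 0%MM)) /eqP.
  by rewrite mcoeffB mcoeffX mcoeff1 (negPf a0) eqxx mcoeff0 subr0 oner_eq0.
- exact: T h3.
- exact: T h4.
- rewrite rf_invM rf_invB rf_inv1 rf_inv_monom rfM rfB rf1.
  by apply: geometric_reciprocity h5; apply: rf_monom_neq0.
Qed.

End RationalSeries.

(** * Labelled partitions *)

Section Counting.
Context {n : nat} {V : finType}.
Implicit Types (f g : {ffun V -> int}) (e a : 'X_{1..n}) (U : {set V}).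

(** The two maps lie in a common closed chamber of the braid arrangement: no two ends are ordered
    strictly oppositely by them. *)
Definition comonotone f g := forall v w, 0 <= (f v - f w) * (g v - g w).

Context (W : {ffun V -> int} -> 'X_{1..n}).
Hypothesis W_add : forall f g, comonotone f g -> W (f + g) = (W f + W g)%MM.
Hypothesis W_bound : forall f v w, (absz (f v - f w) <= mdeg (W f))%N.

Definition box (d : nat) : seq {ffun V -> int} :=
  [seq [ffun v => (g v : nat)%:Z - d%:Z] | g : {ffun V -> 'I_(2 * d).+1}].

Lemma box_uniq d : uniq (box d).
Proof.
rewrite map_inj_uniq ?enum_uniq // => g h /ffunP E.
by apply/ffunP => v; apply/val_inj; have := E v; rewrite !ffunE /=; lia.
Qed.

Lemma mem_box d f : (forall v, `|f v| <= d)%N -> f \in box d.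
Proof.
move=> hf; apply/mapP; exists [ffun v => inord (absz (f v + d%:Z))].
  by rewrite mem_enum.
apply/ffunP => v; rewrite !ffunE inordK; have := hf v; move: (f v) => x; lia.
Qed.

(** Adding [a] on the left avoids the truncated difference of exponents, so that no solution appears
    when [a] does not divide [e]. *)
Definition solutions (A : pred {ffun V -> int}) a e :=
  [seq f <- box (mdeg e) | A f && (W f + a == e)%MM].

Definition pinned (A : pred {ffun V -> int}) :=
  forall f, A f -> exists v, f v = 0.

Lemma solutions_uniq A a e : uniq (solutions A a e).
Proof. by rewrite filter_uniq ?box_uniq. Qed.

Lemma mem_solutions A a e f : pinned A ->
  (f \in solutions A a e) = A f && (W f + a == e)%MM.
Proof.
move=> pA; rewrite mem_filter; apply/andb_idr => /andP[Af /eqP Wf].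
apply: mem_box => v; have [w fw] := pA _ Af.
have := W_bound f v w; rewrite fw -Wf mdegD; lia.
Qed.

Definition counting (A : pred {ffun V -> int}) e : rat := (size (solutions A 0%MM e))%:R.

Lemma shift_counting A a e : pinned A ->
  shift a (counting A) e = (size (solutions A a e))%:R.
Proof.
move=> pA; rewrite /shift /counting; case: ifP => ae.
  congr (_%:R); apply: perm_size; apply: uniq_perm; rewrite ?solutions_uniq //.
  move=> f; rewrite !mem_solutions // addm0; congr (_ && _).
  by apply/eqP/eqP => [->|<-]; rewrite ?submK ?addmK.
rewrite (_ : size _ = 0%N) //; apply/eqP; rewrite size_eq0.
case E: (solutions _ _ _) => [//|f s].
have : f \in solutions A a e by rewrite E mem_head.
rewrite mem_solutions // => /andP[_ /eqP We].
by move: ae; rewrite -We addmC lem_addr.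
Qed.

(** The map [h] is a bijection from [B] onto the part of [A] cut out by [h']. Several counts can
    thus be compared over one fixed list of solutions of [A]. *)
Lemma solutions_transport (A B : pred {ffun V -> int}) a b e h h' :
  pinned A -> pinned B ->
  (forall g, B g -> [/\ A (h g), (W (h g) + a = W g + b)%MM & h' (h g) = g]) ->
  (forall f, A f -> h (h' f) = f) ->
  size (solutions B b e) = count (fun f => B (h' f)) (solutions A a e).
Proof.
move=> pA pB hB hA; rewrite -size_filter -(size_map h).
apply: perm_size; apply: uniq_perm.
- rewrite map_inj_in_uniq ?solutions_uniq // => f g.
  rewrite !mem_solutions // => /andP[/hB[_ _ Ef] _] /andP[/hB[_ _ Eg] _] E.
  by rewrite -Ef -Eg E.
- by rewrite filter_uniq ?solutions_uniq.
move=> f; rewrite mem_filter mem_solutions //; apply/mapP/and3P.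
  move=> [g]; rewrite mem_solutions // => /andP[Bg Wg] ->.
  by have [Ah -> ->] := hB _ Bg.
move=> [Bf Af Wf]; exists (h' f); last by rewrite hA.
rewrite mem_solutions // Bf; have [_ E _] := hB _ Bf.
by rewrite -E hA.
Qed.

Lemma W0 : W 0 = 0%MM.
Proof.
have /W_add : comonotone 0 0 by move=> v w; rewrite !ffunE.
by rewrite addr0 => /mnmP E; apply/mnmP => i; have := E i; rewrite mnmDE mnm0E; lia.
Qed.

(** Constants are comonotone with every map, and the weights of [c] and [- c] are natural exponents
    adding up to [W 0 = 0], so both vanish. *)
Lemma W_translate f (c : int) : W (f + [ffun=> c]) = W f.
Proof.
have cm g x : comonotone g [ffun=> x] by move=> v w; rewrite !ffunE subrr mulr0.
rewrite W_add //; have := W_add (cm [ffun=> c] (- c)).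
have -> : [ffun=> c] + [ffun=> - c] = 0 :> {ffun V -> int}.
  by apply/ffunP => v; rewrite !ffunE subrr.
rewrite W0 => /mnmP E; apply/mnmP => i; have := E i.
by rewrite !mnmDE mnm0E; lia.
Qed.

Context (r : rel V).

Definition lexlt (x i y j : int) := (x < y) || (x == y) && (i < j).

Definition respects (om : V -> int) U f :=
  [forall p in U, forall q in U, r p q ==> lexlt (f p) (om p) (f q) (om q)].

Lemma respectsP om U f :
  reflect (forall p q, p \in U -> q \in U -> r p q ->
             lexlt (f p) (om p) (f q) (om q)) (respects om U f).
Proof.
apply: (iffP forall_inP) => [h p q pU qU rpq|h p pU].
  by have /forall_inP/(_ q qU)/implyP := h p pU; apply.
by apply/forall_inP => q qU; apply/implyP; apply: h.
Qed.

(* The up-set [U] remains after [l], the last end removed, was placed at height 0. *)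
Definition partitions om U l f :=
  [&& [forall v, (v \notin U) ==> (f v == 0)],
      [forall v in U, lexlt 0 (om l) (f v) (om v)] & respects om U f].

Lemma partitionsP om U l f :
  reflect [/\ forall v, v \notin U -> f v = 0,
              forall v, v \in U -> lexlt 0 (om l) (f v) (om v) &
              forall p q, p \in U -> q \in U -> r p q ->
                lexlt (f p) (om p) (f q) (om q)]
          (partitions om U l f).
Proof.
apply: (iffP and3P) => [[/forallP h1 /forall_inP h2 /respectsP h3]|[h1 h2 h3]].
  by split=> // v; move/implyP: (h1 v) => h /h /eqP.
split; [|exact/forall_inP|exact/respectsP].
by apply/forallP => v; apply/implyP => /h1 ->.
Qed.

Definition indicator U : {ffun V -> int} := [ffun v => (nat_of_bool (v \in U))%:Z].

Definition minimal U w := [forall p in U, ~~ r p w].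

Lemma partitions_pinned om U l : l \notin U -> pinned (partitions om U l).
Proof. by move=> lU f /partitionsP[h _ _]; exists l; apply: h. Qed.

Lemma indicator_comonotone U f :
  (forall v, v \notin U -> f v = 0) -> (forall v, v \in U -> 0 <= f v) ->
  comonotone f (indicator U).
Proof.
move=> h1 h2 v w; rewrite !ffunE.
have [vU|vU] := boolP (v \in U); have [wU|wU] := boolP (w \in U);
  rewrite ?subrr ?mulr0 // ?(h1 _ vU) ?(h1 _ wU).
- by rewrite !subr0 mulr1 h2.
- by rewrite !sub0r mulrNN mulr1 h2.
Qed.

Lemma W_indicator_neq0 U v w : v \in U -> w \notin U -> W (indicator U) != 0%MM.
Proof.
move=> vU wU; rewrite -mdeg_eq0 -lt0n.
by apply: leq_trans (W_bound _ v w); rewrite !ffunE vU (negPf wU).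
Qed.

(** Treats uniformly the two cases of a label comparison [b]: the up-set is lifted by one or left in
    place. *)
Definition raise (b : bool) U := indicator (if b then U else set0).

Lemma raiseE b U v : raise b U v = (nat_of_bool (b && (v \in U)))%:Z.
Proof. by rewrite ffunE; case: b; rewrite ?in_set0. Qed.

Lemma sub_raiseE b U f v : (f - raise b U) v = f v - (nat_of_bool (b && (v \in U)))%:Z.
Proof. by rewrite -raiseE !ffunE. Qed.

Lemma add_raiseE b U f v : (f + raise b U) v = f v + (nat_of_bool (b && (v \in U)))%:Z.
Proof. by rewrite -raiseE ffunE. Qed.

Lemma raiseT U : raise true U = indicator U. Proof. by []. Qed.

Lemma W_raise b U : W (raise b U) = if b then W (indicator U) else 0%MM.
Proof.
case: b => //; rewrite /raise (_ : indicator set0 = 0) ?W0 //.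
by apply/ffunP => v; rewrite !ffunE in_set0.
Qed.

Lemma W_add_raise b U f :
  (forall v, v \notin U -> f v = 0) -> (forall v, v \in U -> 0 <= f v) ->
  W (f + raise b U) = (W f + if b then W (indicator U) else 0%MM)%MM.
Proof.
move=> h1 h2; rewrite -W_raise W_add //; case: b; last first.
  by move=> v w; rewrite !raiseE subrr mulr0.
exact: indicator_comonotone.
Qed.

Context (om : V -> int).
Hypothesis om_inj : injective om.

Definition lexmin U f w :=
  forall v, v \in U -> v != w -> lexlt (f w) (om w) (f v) (om v).

(** Minimise the value, then the label among the ties; injectivity of the labels makes the result
    strictly least. *)
Lemma lexmin_exists U f : U != set0 ->
  exists2 w, w \in U & lexmin U f w.
Proof.
move=> /set0Pn[u uU].
have [x xU xmin] := @Order.TotalTheory.arg_minP _ int V u (mem U) f uU.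
have xP : (x \in U) && (f x == f x) by rewrite eqxx andbT; exact: xU.
have [w /andP[wU /eqP fw] wmin] :=
  @Order.TotalTheory.arg_minP _ int V x (fun v => (v \in U) && (f v == f x)) om xP.
exists w => // v vU vw.
have om_vw : om v != om w by rewrite (inj_eq om_inj).
have := xmin v vU; have := wmin v; rewrite vU /= /lexlt fw => a b.
move: a b om_vw; case: eqVneq => [->|]; last lia.
by move=> /(_ isT); lia.
Qed.

Lemma lexmin_unique U f w w' :
  w \in U -> w' \in U -> lexmin U f w -> lexmin U f w' -> w = w'.
Proof.
move=> wU w'U m m'; case: (eqVneq w w') => // ne.
have := m _ w'U; have := m' _ wU; rewrite [w' == w]eq_sym ne /lexlt.
by move=> /(_ isT) + /(_ isT); lia.
Qed.

(** An end of [U] related to [w] would have to precede [w] lexicographically. *)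
Lemma lexmin_minimal U f w :
  w \in U -> respects om U f -> lexmin U f w -> minimal U w.
Proof.
move=> wU /respectsP fU m; apply/forall_inP => p pU; apply/negP => /(fU _ _ pU wU).
have := m p pU; case: eqVneq => [-> _|_ /(_ isT)]; rewrite /lexlt /=; lia.
Qed.

(** Lowering [U] keeps all comparisons inside [U]; among the comparisons with [l], that of the least
    end [w] is the tightest. *)
Lemma partitions_lower U l f w :
  w \in U -> partitions om U l f -> lexmin U f w ->
  partitions om U l (f - indicator U) = lexlt 0 (om l) (f w - 1) (om w).
Proof.
move=> wU /partitionsP[f1 f2 f3] m; apply/partitionsP/idP.
  by move=> [_ /(_ w wU) + _]; rewrite !ffunE wU.
move=> lw; split=> [v vU|v vU|p q pU qU rpq]; rewrite !ffunE.
- by rewrite f1 // (negPf vU).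
- rewrite vU; move: lw; case: (eqVneq v w) => [-> //|/(m v vU)].
  by rewrite /lexlt /=; lia.
- by rewrite pU qU; move: (f3 _ _ pU qU rpq); rewrite /lexlt /=; lia.
Qed.

(** The lowest height allowed to [w] is 1 if [om w < om l] and 0 otherwise. Subtracting [raise]
    therefore brings a least end that cannot be lowered to height 0, where it serves as the new last
    end. *)
Lemma partitions_remove U l f w : l \notin U -> w \in U -> partitions om U l f ->
  partitions om (U :\ w) w (f - raise (om w < om l) U) <->
  lexmin U f w /\ ~~ lexlt 0 (om l) (f w - 1) (om w).
Proof.
move=> lU wU /partitionsP[f1 f2 f3].
have lw : om w != om l by rewrite (inj_eq om_inj); apply: contraNneq lU => <-.
have := f2 w wU; split=> [/partitionsP[g1 g2 _]|[m fw]].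
  have := g1 w; rewrite in_setD1 eqxx sub_raiseE wU andbT => /(_ isT) gw.
  split; last by move: gw lw; rewrite /lexlt; case: ltP => /=; lia.
  move=> v vU vw; have := g2 v; rewrite in_setD1 vU vw => /(_ isT).
  by rewrite sub_raiseE vU andbT; move: gw; rewrite /lexlt /=; lia.
apply/partitionsP; split=> [v|v|p q].
- rewrite in_setD1 negb_and negbK sub_raiseE.
  have [-> _|_ /= vU] := eqVneq v w; last by rewrite f1 // (negPf vU) andbF subr0.
  by rewrite wU andbT; move: (f2 w wU) fw lw; rewrite /lexlt; case: ltP => /=; lia.
- rewrite in_setD1 => /andP[vw vU]; rewrite sub_raiseE vU andbT.
  by move: (m v vU vw) (f2 w wU) fw lw; rewrite /lexlt; case: ltP => /=; lia.
- rewrite !in_setD1 => /andP[_ pU] /andP[_ qU] rpq; have := f3 _ _ pU qU rpq.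
  by rewrite !sub_raiseE pU qU /lexlt /=; lia.
Qed.

Lemma partitions_nonneg U l f : partitions om U l f -> forall v, 0 <= f v.
Proof.
move=> /partitionsP[f1 f2 _] v; have [/f2|/f1 ->//] := boolP (v \in U).
by rewrite /lexlt /=; lia.
Qed.

Lemma partitions_lift U l g :
  partitions om U l g -> partitions om U l (g + indicator U).
Proof.
move=> /partitionsP[g1 g2 g3].
apply/partitionsP; split=> [v vU|v vU|p q pU qU rpq]; rewrite !ffunE.
- by rewrite g1 // (negPf vU).
- by rewrite vU; move: (g2 v vU); rewrite /lexlt /=; lia.
- by rewrite pU qU; move: (g3 _ _ pU qU rpq); rewrite /lexlt /=; lia.
Qed.

(** By minimality no relation within [U] ends at [w], and those starting at [w] hold because [w]
    precedes the rest of [U]. *)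
Lemma partitions_insert U l g w : l \notin U -> w \in U -> minimal U w ->
  partitions om (U :\ w) w g -> partitions om U l (g + raise (om w < om l) U).
Proof.
move=> lU wU /forall_inP wmin /partitionsP[g1 g2 g3].
have lw : om w != om l by rewrite (inj_eq om_inj); apply: contraNneq lU => <-.
have gw : g w = 0 by apply: g1; rewrite in_setD1 eqxx.
have gv v : v \in U -> v != w -> lexlt 0 (om w) (g v) (om v).
  by move=> vU vw; apply: g2; rewrite in_setD1 vw.
apply/partitionsP; split=> [v vU|v vU|p q pU qU rpq].
- rewrite add_raiseE (negPf vU) andbF addr0 g1 //.
  by rewrite in_setD1 negb_and vU orbT.
- rewrite add_raiseE vU andbT.
  have [->|/(gv v vU)] := eqVneq v w; first by rewrite gw /lexlt; case: ltP lw => /=; lia.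
  by move: lw; rewrite /lexlt; case: ltP => /=; lia.
- rewrite !add_raiseE pU qU.
  have qw : q != w.
    by apply/eqP => qw; have := wmin p pU; rewrite -qw rpq.
  have [pw|pw] := eqVneq p w.
    by rewrite pw gw; have := gv q qU qw; rewrite /lexlt /=; lia.
  have := g3 p q; rewrite !in_setD1 pw qw pU qU => /(_ isT isT rpq).
  by rewrite /lexlt /=; lia.
Qed.

(** Exactly one alternative occurs: all of [U] can be lowered, or its lexicographically least end,
    which is unique, is removed. *)
Lemma partitions_split U l f : U != set0 -> l \notin U -> partitions om U l f ->
  (partitions om U l (f - indicator U)%R +
   \sum_(w in U | minimal U w)
      partitions om (U :\ w) w (f - raise (om w < om l)%R U)%R = 1)%N.
Proof.
move=> U0 lU fP; have [w wU m] := lexmin_exists f U0.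
have wmin : minimal U w.
  by apply: lexmin_minimal m => //; case/and3P: fP.
rewrite (partitions_lower wU fP m) (bigD1 w) /= ?wU // big1 => [|v /andP[/andP[vU _] vw]].
  rewrite addn0; have [_ h2] := partitions_remove lU wU fP.
  have [h1 _] := partitions_remove lU wU fP.
  case E: (lexlt _ _ _ _); case E': (partitions _ _ _ _) => //.
    by case: (h1 E') => _; rewrite E.
  by move: h2; rewrite E E' => /(_ (conj m isT)).
apply/eqP; rewrite eqb0; apply/negP => /(partitions_remove lU vU fP)[m' _].
by move: vw; rewrite (lexmin_unique vU wU m' m) eqxx.
Qed.

(** Sums [partitions_split] over the maps of a given weight; the shifts record the weight of the
    subtracted indicator, which is additive since the maps are nonnegative on [U] and zero off
    it. *)
Lemma counting_recursion U l e : U != set0 -> l \notin U ->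
  counting (partitions om U l) e =
    shift (W (indicator U)) (counting (partitions om U l)) e +
    \sum_(w in U | minimal U w)
      shift (if om w < om l then W (indicator U) else 0%MM)
        (counting (partitions om (U :\ w) w)) e.
Proof.
move=> U0 lU; have pU := @partitions_pinned om U l lU.
have pw w : pinned (partitions om (U :\ w) w).
  by apply: partitions_pinned; rewrite in_setD1 eqxx.
rewrite shift_counting //; under eq_bigr => w _ do rewrite shift_counting //.
rewrite -natr_sum -natrD /counting; congr (_%:R).
have -> : size (solutions (partitions om U l) (W (indicator U)) e) =
    count (fun f => partitions om U l (f - indicator U))
      (solutions (partitions om U l) 0%MM e).
  rewrite (@solutions_transport (partitions om U l) _ 0%MM _ e
    (fun f => f + indicator U) (fun f => f - indicator U)) // => [g gP|f _]; last first.
    by rewrite subrK.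
  rewrite partitions_lift // addrK; split=> //; rewrite addm0 -raiseT.
  have [? _ _] := partitionsP _ _ _ _ gP; rewrite W_add_raise // => v _.
  exact: partitions_nonneg gP v.
under eq_bigr => w /andP[wU wmin].
  rewrite (@solutions_transport (partitions om U l) _ 0%MM _ e
    (fun f => f + raise (om w < om l) U) (fun f => f - raise (om w < om l) U)) //; last first.
  - by move=> f _; rewrite subrK.
  - move=> g gP; rewrite partitions_insert // addrK; split=> //.
    have [g1 _ _] := partitionsP _ _ _ _ gP; rewrite addm0 W_add_raise // => v vU.
      by apply: g1; rewrite in_setD1 negb_and vU orbT.
    exact: partitions_nonneg gP v.
over.
(* All terms are now counts over the same list, so an induction on it adds up [partitions_split]. *)
have : all (partitions om U l) (solutions (partitions om U l) 0%MM e).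
  by apply/allP => f; rewrite mem_solutions // => /andP[].
elim: (solutions _ _ _) => [|f s IH] /=; first by rewrite big1.
case/andP => fP /IH {}IH; rewrite big_split /= addnACA -IH.
by rewrite partitions_split.
Qed.

Definition normalized w0 f := (f w0 == 0) && respects om setT f.

Lemma normalizedP w0 f :
  reflect (f w0 = 0 /\ forall p q, r p q -> lexlt (f p) (om p) (f q) (om q))
          (normalized w0 f).
Proof.
apply: (iffP andP) => -[f0 fr]; split; try exact/eqP.
  by move=> p q rpq; apply: (respectsP _ _ _ fr); rewrite ?in_setT.
by apply/respectsP => p q _ _; apply: fr.
Qed.

Lemma normalized_pinned w0 : pinned (normalized w0).
Proof. by move=> f /andP[/eqP f0 _]; exists w0. Qed.

Lemma translateE f (c : int) v : (f + [ffun=> c]) v = f v + c.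
Proof. by rewrite !ffunE. Qed.

Lemma partitions_translate f w : respects om setT f ->
  partitions om (setT :\ w) w (f + [ffun=> - f w]) <-> lexmin setT f w.
Proof.
move=> /respectsP fr; split=> [/partitionsP[_ h _] v _ vw|m].
  have := h v; rewrite !inE vw => /(_ isT); rewrite translateE /lexlt; lia.
apply/partitionsP; split=> [v|v|p q _ _ rpq]; rewrite ?inE ?andbT !translateE.
- by rewrite negbK => /eqP ->; rewrite subrr.
- by move=> vw; move: (m v (in_setT _) vw); rewrite /lexlt; lia.
- by move: (fr _ _ (in_setT _) (in_setT _) rpq); rewrite /lexlt; lia.
Qed.

Lemma partitions_normalized w0 w g : minimal setT w ->
  partitions om (setT :\ w) w g -> normalized w0 (g + [ffun=> - g w0]).
Proof.
move=> /forall_inP wmin /partitionsP[g1 g2 g3]; apply/normalizedP.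
split=> [|p q rpq]; rewrite !translateE; first by rewrite subrr.
have gw : g w = 0 by apply: g1; rewrite in_setD1 eqxx.
have qw : q != w by apply/eqP => qw; have := wmin p (in_setT _); rewrite -qw rpq.
have [pw|pw] := eqVneq p w.
  by rewrite pw gw; have := g2 q; rewrite !inE qw /lexlt => /(_ isT); lia.
by have := g3 p q; rewrite !inE pw qw /lexlt => /(_ isT isT rpq); lia.
Qed.

(** Each map is translated so that its least end, instead of [w0], has height 0; translation does
    not change the weight, and the least end is unique and minimal for [r]. *)
Lemma counting_normalized w0 e :
  counting (normalized w0) e =
  \sum_(w | minimal setT w) counting (partitions om (setT :\ w) w) e.
Proof.
have pw w : pinned (partitions om (setT :\ w) w).
  by apply: partitions_pinned; rewrite in_setD1 eqxx.
have pG := @normalized_pinned w0.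
have V0 : setT != set0 :> {set V} by apply/set0Pn; exists w0; rewrite in_setT.
rewrite /counting -natr_sum; congr (_%:R).
under eq_bigr => w wmin.
  rewrite (@solutions_transport (normalized w0) _ 0%MM _ e
    (fun g => g + [ffun=> - g w0]) (fun f => f + [ffun=> - f w])) //; last first.
  - move=> f /andP[/eqP f0 _]; apply/ffunP => v; rewrite !translateE f0; lia.
  - move=> g gP; split; first exact: partitions_normalized gP.
      by rewrite W_translate.
    have [g1 _ _] := partitionsP _ _ _ _ gP.
    have gw : g w = 0 by apply: g1; rewrite in_setD1 eqxx.
    by apply/ffunP => v; rewrite !translateE gw; lia.
over.
have : all (normalized w0) (solutions (normalized w0) 0%MM e).
  by apply/allP => f; rewrite mem_solutions // => /andP[].
elim: (solutions _ _ _) => [|f s IH] /=; first by rewrite big1.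
case/andP => /andP[_ fP] /IH {}IH; rewrite big_split /= -IH -add1n; congr (_ + _)%N.
have [w _ m] := lexmin_exists f V0.
have wmin : minimal setT w by apply: lexmin_minimal m; rewrite ?in_setT.
rewrite (bigD1 w) //= big1 => [|v /andP[vmin vw]].
  by have [_ ->] := partitions_translate w fP.
apply/eqP; rewrite eqb0; apply/negP => /(partitions_translate v fP) m'.
by move: vw; rewrite (lexmin_unique _ _ m' m) ?in_setT // eqxx.
Qed.
End Counting.

(** Combines [F(1/X) = s F'] with [X^a F' = X^b F], both over the denominator [Q], to eliminate
    [F']. *)
Lemma quotient_reciprocity (K : fieldType) (s p p' q ip iq a b : K) :
  q != 0 -> iq != 0 -> ip * q = s * p' * iq -> a * p' = b * p ->
  ip / iq * a = s * b * (p / q).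
Proof.
move=> q0 iq0 h E; apply: (mulIf (mulf_neq0 q0 iq0)).
transitivity (ip * q * a); first by field.
rewrite h; transitivity (s * iq * (a * p')); first by ring.
by rewrite E; field.
Qed.

(** * Reciprocity for labelled partitions *)

Section Reciprocity.
Context {n : nat} {V : finType} (W : {ffun V -> int} -> 'X_{1..n}).
Hypothesis W_add :
  forall f g : {ffun V -> int}, comonotone f g -> W (f + g) = (W f + W g)%MM.
Hypothesis W_bound :
  forall (f : {ffun V -> int}) v w, (absz (f v - f w) <= mdeg (W f))%N.
Context (r : rel V) (om : V -> int).
Hypothesis om_inj : injective om.

(** Negating the labels exchanges the weak and the strict inequalities. *)
Let om' (v : V) : int := - om v.

Lemma opp_inj : injective om'.
Proof. by move=> v w /oppr_inj /om_inj. Qed.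

Lemma counting_partitions0 (s : V -> int) l e :
  counting W (partitions r s set0 l) e = (e == 0%MM)%:R.
Proof.
have pA : pinned (partitions r s set0 l) by apply: partitions_pinned; rewrite in_set0.
have W0' : W 0 = 0%MM by apply: W0.
have zP f : partitions r s set0 l f = (f == 0).
  apply/partitionsP/eqP => [[h _ _]|->].
    by apply/ffunP => v; rewrite h ?in_set0 // ffunE.
  by split=> [v _|v|p q]; rewrite ?in_set0 // ffunE.
rewrite /counting.
have [->|e0] := eqVneq e 0%MM.
  rewrite (_ : size _ = size [:: 0 : {ffun V -> int}]) //.
  apply: perm_size; apply: uniq_perm; rewrite ?solutions_uniq // => f.
  rewrite mem_solutions // mem_seq1 zP; case: eqVneq => [->|//].
  by rewrite W0' addm0 eqxx.
rewrite (_ : size _ = 0%N) //; apply/eqP; rewrite size_eq0.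
case E: (solutions _ _ _ _) => [//|f t].
have : f \in solutions W (partitions r s set0 l) 0%MM e by rewrite E mem_head.
rewrite mem_solutions // zP => /andP[/eqP -> /eqP e1].
by move: e0; rewrite -e1 W0' addm0 eqxx.
Qed.

(** Induction on the size of [U]: removing an end contributes [1/X_U] through the shift and [- X_U]
    through the geometric series, so that only a sign is left. *)
Lemma reciprocal_partitions k (U : {set V}) l : #|U| = k -> l \notin U ->
  reciprocal ((-1) ^+ k) (counting W (partitions r om U l))
                         (counting W (partitions r om' U l)).
Proof.
elim: k U l => [|k IH] U l Uk lU.
  have -> : U = set0 by apply/eqP; rewrite -cards_eq0 Uk.
  have T s N : eqtrunc N (1 * trunc (counting W (partitions r s set0 l)) N) 1.
    move=> e he; rewrite mul1r trunc_coef // counting_partitions0 mcoeff1.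
    by rewrite eq_sym.
  exists 1, 1, 1; split; rewrite ?rf_inv1 ?rf1 ?mcoeff1 ?eqxx ?oner_eq0 //.
  by rewrite expr0 !mulr1.
have U0 : U != set0 by rewrite -cards_eq0 Uk.
have [v vU] := set0Pn _ U0.
have a0 := W_indicator_neq0 W_bound vU lU.
set a := W (indicator U) in a0.
pose G (s : V -> int) e := \sum_(w in U | minimal r U w)
  shift (if s w < s l then a else 0%MM) (counting W (partitions r s (U :\ w) w)) e.
have -> : (-1) ^+ k.+1 = - ((-1) ^+ k / rf 'X_[a] * rf 'X_[a]) :> ratfun n.
  by rewrite mulfVK ?rf_monom_neq0 // exprS mulN1r.
apply: (@reciprocal_geom _ _ _ _ _ (G om) (G om') a0); last 2 first.
- by move=> e; apply: counting_recursion.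
- by move=> e; apply: counting_recursion => //; apply: opp_inj.
apply: reciprocal_sum => w /andP[wU _].
have := @reciprocal_shift n a (om w < om l) _ _ _ (IH (U :\ w) w _ _).
rewrite in_setD1 eqxx => /(_ _ isT).
(* Reversing the labels reverses this comparison, so exactly one of the two series is shifted, as in
   [reciprocal_shift]. *)
have -> : (if om' w < om' l then a else 0%MM) = if om w < om l then 0%MM else a.
  rewrite /om' ltrN2; have : om w != om l.
    by rewrite (inj_eq om_inj); apply: contraNneq lU => <-.
  by case: ltgtP.
by apply; have := cardsD1 w U; rewrite wU Uk => -[].
Qed.

Lemma reciprocal_normalized w0 :
  reciprocal ((-1) ^+ #|V|.-1) (counting W (normalized r om w0))
                               (counting W (normalized r om' w0)).
Proof.
apply: (@reciprocal_ext _ _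
  (fun e => \sum_(w | minimal r setT w) counting W (partitions r om (setT :\ w) w) e)
  (fun e => \sum_(w | minimal r setT w) counting W (partitions r om' (setT :\ w) w) e)).
- by move=> e; rewrite counting_normalized.
- by move=> e; rewrite counting_normalized //; apply: opp_inj.
apply: reciprocal_sum => w _; apply: reciprocal_partitions.
  by rewrite -cardsT (cardsD1 w setT) in_setT.
by rewrite in_setD1 eqxx.
Qed.

(** Since [delta] rises by one along weak relations and falls by one along strict ones, adding it
    identifies the maps for [om] with those for [om']; [a] and [b] record the change of weight. *)
Lemma shifted_reciprocity w0 (delta : {ffun V -> int}) (a b : 'X_{1..n}) :
  delta w0 = 0 ->
  (forall p q, r p q -> delta q - delta p = if om p < om q then 1 else -1) ->
  (forall f, normalized r om w0 f -> (W (f + delta)%R + a = W f + b)%MM) ->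
  exists P Q : {mpoly rat[n]}, [/\ Q@_0%MM != 0,
    forall e, series_mul_coef Q (counting W (normalized r om w0)) e = P@_e &
    rf_inv P / rf_inv Q * rf 'X_[a] = (-1) ^+ #|V|.-1 * rf 'X_[b] * (rf P / rf Q)].
Proof.
move=> d0 dr dW; have [P [P' [Q [Q0 iQ0 hP hP' E]]]] := reciprocal_normalized w0.
have q0 : rf Q != 0.
  by rewrite rf_neq0; apply: contraNneq Q0 => ->; rewrite mcoeff0.
have pG s : pinned (normalized r s w0) by apply: normalized_pinned.
have dE (f : {ffun V -> int}) v : (f + delta) v = f v + delta v by rewrite ffunE.
have om_neq p q : r p q -> om p != om q.
  move=> rpq; apply/eqP => /om_inj pq; have := dr p q rpq.
  by rewrite pq subrr; case: ifP.
have revE f : normalized r om' w0 (f + delta) = normalized r om w0 f.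
  apply/normalizedP/normalizedP => -[]; rewrite dE d0 addr0 => f0 fr;
    split=> // p q rpq; have := fr p q rpq; have := dr p q rpq;
    have := om_neq p q rpq; rewrite !dE /lexlt /om'; case: ltP; lia.
have shiftE e : shift a (counting W (normalized r om' w0)) e =
                shift b (counting W (normalized r om w0)) e.
  rewrite !shift_counting //; congr (_%:R); symmetry.
  rewrite (@solutions_transport _ _ W W_bound (normalized r om' w0) _ a b e
    (fun f => f + delta) (fun f => f - delta)) //.
  - apply/eqP; rewrite -all_count; apply/allP => f.
    by rewrite mem_solutions // => /andP[+ _]; rewrite -revE subrK.
  - by move=> g gP; rewrite revE addrK; split=> //; apply: dW.
  - by move=> f _; rewrite subrK.
(* Over the common denominator [Q], equality of the shifted series becomes equality of polynomial
   numerators. *)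
have PE : 'X_[a] * P' = 'X_[b] * P.
  apply: eqtrunc_eq => N e he.
  rewrite -(shift_generated a hP' he) -(shift_generated b hP he).
  by rewrite /trunc; under eq_bigr => d _ do rewrite shiftE.
exists P, Q; split=> // [e|].
  by rewrite (@series_mul_coefE _ _ _ (mdeg e).+1) // (hP (mdeg e).+1).
have := congr1 (@rf n) PE; rewrite !rfM; exact: (quotient_reciprocity q0 iQ0 E).
Qed.
End Reciprocity.

(** * Weights of column data *)

Section WeightLemmas.
Implicit Types (b t : nat -> int).

(** A nonnegative product means weakly equal signs, and [ppart] is linear on each half-line. *)
Lemma ppartD (x y : int) : 0 <= x * y -> ppart (x + y) = (ppart x + ppart y)%N.
Proof.
move=> xy; have : (0 <= x) && (0 <= y) || (x <= 0) && (y <= 0) by nia.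
by rewrite /ppart; do 3![case: ifP => ?]; lia.
Qed.

Lemma abszD (x y : int) : 0 <= x * y -> absz (x + y) = (absz x + absz y)%N.
Proof.
move=> xy; have : (0 <= x) && (0 <= y) || (x <= 0) && (y <= 0) by nia.
by lia.
Qed.

Lemma expo_vid m b t (k : 'I_4) (i : 'I_m.+1) :
  expo m b t (vid k i) =
    nth 0%N [:: Ntop m b t i; Stop m b t i; Nbot m b t i; Sbot m b t i] k.
Proof.
rewrite /expo /= divnMDl // modnMDl divn_small // modn_small // addn0.
by case: k => [[|[|[|[|]]]]].
Qed.

Lemma vidP m (j : 'I_(nvars m)) : exists k i, j = vid k i.
Proof.
have jk : (j %/ m.+1 < 4)%N by rewrite ltn_divLR // (ltn_ord j).
have ji : (j %% m.+1 < m.+1)%N by rewrite ltn_mod.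
by exists (Ordinal jk), (Ordinal ji); apply: val_inj; rewrite /= -divn_eq.
Qed.

Lemma vid_eq m (k k' : 'I_4) (i i' : 'I_m.+1) :
  (vid k i == vid k' i') = (k == k') && (i == i').
Proof.
apply/eqP/andP => [[E]|[/eqP -> /eqP ->] //].
have := congr1 (modn^~ m.+1) E; rewrite !modnMDl !modn_small // => ii.
have := congr1 (divn^~ m.+1) E; rewrite !divnMDl // !divn_small // !addn0 => kk.
by split; apply/eqP/val_inj.
Qed.

Lemma weightP m b t (a : 'X_{1..nvars m}) b' t' (a' : 'X_{1..nvars m}) :
  (forall i : 'I_m.+1,
    [/\ (Ntop m b t i + a (vid 0%R i) = Ntop m b' t' i + a' (vid 0%R i))%N,
        (Stop m b t i + a (vid 1%R i) = Stop m b' t' i + a' (vid 1%R i))%N,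
        (Nbot m b t i + a (vid 2%R i) = Nbot m b' t' i + a' (vid 2%R i))%N &
        (Sbot m b t i + a (vid 3%R i) = Sbot m b' t' i + a' (vid 3%R i))%N]) ->
  (weight m b t + a = weight m b' t' + a')%MM.
Proof.
move=> h; apply/mnmP => j; have [k [i ->]] := vidP j.
rewrite !mnmDE !mnmE !expo_vid; have [h0 h1 h2 h3] := h i.
have [->|[->|[->|->]]] // : k = 0 \/ k = 1 \/ k = 2 \/ k = 3.
by case: k => [[|[|[|[|//]]]] hk]; [left|right;left|right;right;left|right;right;right];
  apply: val_inj.
Qed.

Lemma weight_ext m b t b' t' : b =1 b' -> t =1 t' -> weight m b t = weight m b' t'.
Proof.
move=> hb ht; apply/mnmP => j; rewrite !mnmE /expo /Ntop /Stop /Nbot /Sbot.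
by rewrite !hb !ht.
Qed.

Lemma in_class_ext c m b t b' t' : b =1 b' -> t =1 t' ->
  in_class c m b t = in_class c m b' t'.
Proof.
move=> hb ht; case: c; rewrite /in_class //; repeat (congr (_ && _) || (apply: eq_forallb => i));
  by rewrite /Stop /Nbot /Sbot ?hb ?ht.
Qed.

Lemma is_ccpoly_ext m b t b' t' : b =1 b' -> t =1 t' ->
  is_ccpoly m b t = is_ccpoly m b' t'.
Proof.
move=> hb ht; rewrite /is_ccpoly hb; congr [&& _, _ & _];
  by apply: eq_forallb => i; rewrite !hb !ht.
Qed.

(** Every exponent is the absolute value or the positive part of a difference of two ends, and the
    hypotheses give these differences equal signs in both data. *)
Lemma weightD m b t b' t' : (0 < m)%N ->
  (forall i j, (i < m)%N -> (j < m)%N -> 0 <= (b i - b j) * (b' i - b' j)) ->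
  (forall i j, (i < m)%N -> (j < m)%N -> 0 <= (t i - t j) * (t' i - t' j)) ->
  (forall i, (i < m)%N -> 0 <= (t i - b i) * (t' i - b' i)) ->
  weight m (fun j => b j + b' j) (fun j => t j + t' j) =
    (weight m b t + weight m b' t')%MM.
Proof.
move=> m0 hb ht hbt.
have E (x x' y y' : int) : x + x' - (y + y') = (x - y) + (x' - y') by lia.
apply/mnmP => j; have [k [i ->]] := vidP j; rewrite mnmDE !mnmE !expo_vid.
have pm : (m.-1 < m)%N by rewrite prednK.
case: k => [[|[|[|[|//]]]] hk] /=; rewrite /Ntop /Stop /Nbot /Sbot !E.
- case: eqP => // _; first by rewrite abszD ?hbt.
  case: ifP => // im; rewrite ppartD // ht //.
  exact: leq_ltn_trans (leq_pred i) im.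
- case: ifP => // /andP[i0 im]; rewrite ppartD // ht //.
  exact: leq_ltn_trans (leq_pred i) im.
- case: ifP => [/andP[i0 im]|_].
    by rewrite ppartD // hb // (leq_ltn_trans (leq_pred i) im).
  by case: eqP => // _; rewrite abszD ?hbt.
- case: ifP => // /andP[i0 im]; rewrite ppartD // hb //.
  exact: leq_ltn_trans (leq_pred i) im.
Qed.

Lemma mdeg_weight m b t :
  mdeg (weight m b t) =
  (\sum_(i < m.+1) (Ntop m b t i + Stop m b t i + Nbot m b t i + Sbot m b t i))%N.
Proof.
rewrite mdegE (reindex (fun p : 'I_4 * 'I_m.+1 => vid p.1 p.2)) /=; last first.
  exists (fun j => (inord (j %/ m.+1), inord (j %% m.+1))) => [[k i] _|j _].
    congr pair; apply: val_inj; rewrite /= inordK /=.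
    - by rewrite divnMDl // divn_small // addn0.
    - by rewrite divnMDl // divn_small // addn0.
    - by rewrite modnMDl modn_small.
    - by rewrite modnMDl modn_small.
  have [k [i ->]] := vidP j; apply/eqP; rewrite vid_eq /= divnMDl // modnMDl.
  by rewrite divn_small // modn_small // addn0 !inord_val !eqxx.
rewrite -(pair_bigA _ (fun k i => weight m b t (vid k i))) exchange_big /=.
apply: eq_bigr => i _; rewrite !big_ord_recl big_ord0 addn0 !addnA.
by rewrite !mnmE !expo_vid.
Qed.

Lemma absz_ppart (x y : int) : absz (x - y) = (ppart (x - y) + ppart (y - x))%N.
Proof. by rewrite /ppart; do 2![case: ifP => ?]; lia. Qed.

Lemma absz_triangle (x y z : int) : (absz (x - z) <= absz (x - y) + absz (y - z))%N.
Proof. lia. Qed.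

Lemma absz_sym (x y : int) : absz (x - y) = absz (y - x).
Proof. lia. Qed.

Lemma telescope_bound (x : nat -> int) M j k : (j <= M)%N -> (k <= M)%N ->
  (absz (x j - x k) <= \sum_(i < M) absz (x i.+1 - x i))%N.
Proof.
have last N l : (forall l, (l <= N)%N ->
    (absz (x N - x l) <= \sum_(i < N) absz (x i.+1 - x i))%N) ->
    (l <= N)%N -> (absz (x N.+1 - x l) <= \sum_(i < N.+1) absz (x i.+1 - x i))%N.
  move=> h lN; rewrite big_ord_recr /=.
  apply: leq_trans (absz_triangle _ (x N) _) _.
  by rewrite addnC leq_add2r h.
elim: M j k => [|M IH] j k.
  by rewrite !leqn0 => /eqP -> /eqP ->; rewrite subrr.
have IHM l : (l <= M)%N -> (absz (x M - x l) <= \sum_(i < M) absz (x i.+1 - x i))%N.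
  exact: IH.
rewrite leq_eqVlt => /orP[/eqP ->|jM]; rewrite leq_eqVlt => /orP[/eqP ->|kM].
- by rewrite subrr.
- exact: last.
- by rewrite absz_sym; apply: last.
- by rewrite big_ord_recr /=; apply: leq_trans (IH j k jM kM) (leq_addr _ _).
Qed.

(** Counts the left edge and the steps on the inner lines, dropping the right edge. *)
Lemma weight_lower_bound M b t :
  (absz (t 0%N - b 0%N) + \sum_(i < M) absz (t i.+1 - t i)
     + \sum_(i < M) absz (b i.+1 - b i) <= mdeg (weight M.+1 b t))%N.
Proof.
rewrite mdeg_weight big_ord_recl big_ord_recr /= -addnA -big_split /=.
apply: leq_add; first by rewrite -!addnA leq_addr.
apply: leq_trans (leq_addr _ _).
apply: leq_sum => i _; rewrite /Ntop /Stop /Nbot /Sbot /bump /= ?add1n /= ltnS ltn_ord.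
by rewrite add0n !absz_ppart !addnA.
Qed.
End WeightLemmas.

(** The default 0 is that of [box_decode], so that decoded columns are of this form by
    conversion. *)
Definition extend m (x : 'I_m -> int) (j : nat) : int := oapp x 0 (insub j).

Lemma extendE m (x : 'I_m -> int) (i : 'I_m) : extend x i = x i.
Proof. by rewrite /extend valK. Qed.

Lemma extend_eq m (x y : 'I_m -> int) : x =1 y -> extend x =1 extend y.
Proof. by move=> xy j; rewrite /extend; case: insub => //= i. Qed.

(** * Polygons as integer maps on the column ends *)

Section Columns.
Context {M : nat} {V : finType} (beta tau : 'I_M.+1 -> V).
Local Notation m := M.+1.
Implicit Types (f g : {ffun V -> int}) (b t : nat -> int).

(** [beta] may fail to be injective: Ferrers diagrams and bar-graphs have a single end for all
    bottoms. *)
Definition bot f := extend (fun i => f (beta i)).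
Definition top f := extend (fun i => f (tau i)).
Definition colweight f := weight m (bot f) (top f).

Lemma botE f (i : 'I_m) : bot f i = f (beta i). Proof. exact: extendE. Qed.
Lemma topE f (i : 'I_m) : top f i = f (tau i). Proof. exact: extendE. Qed.

Lemma botD f g : bot (f + g) =1 fun j => bot f j + bot g j.
Proof.
by move=> j; rewrite /bot /extend; case: insub => [i|] /=; rewrite ?ffunE ?addr0.
Qed.

Lemma topD f g : top (f + g) =1 fun j => top f j + top g j.
Proof.
by move=> j; rewrite /top /extend; case: insub => [i|] /=; rewrite ?ffunE ?addr0.
Qed.

Lemma colweightD f g : comonotone f g ->
  colweight (f + g) = (colweight f + colweight g)%MM.
Proof.
move=> cm; rewrite /colweight (weight_ext m (botD f g) (topD f g)).
apply: weightD => // [i j im jm|i j im jm|i im].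
- by rewrite !(botE _ (Ordinal im)) !(botE _ (Ordinal jm)) cm.
- by rewrite !(topE _ (Ordinal im)) !(topE _ (Ordinal jm)) cm.
- by rewrite !(botE _ (Ordinal im)) !(topE _ (Ordinal im)) cm.
Qed.

Hypothesis cover : forall v, exists i, v = beta i \/ v = tau i.

(** Any two ends are joined by a walk along the bottom, the left edge and the top, whose vertical
    length the degree bounds. *)
Lemma colweight_bound f v w : (absz (f v - f w) <= mdeg (colweight f))%N.
Proof.
apply: leq_trans (weight_lower_bound _ _ _).
have tb (i : 'I_m) : (i <= M)%N by rewrite -ltnS.
have bb (i j : 'I_m) := telescope_bound (bot f) (tb i) (tb j).
have tt (i j : 'I_m) := telescope_bound (top f) (tb i) (tb j).
have tbot (i j : 'I_m) : (absz (top f i - bot f j) <=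
    absz (top f 0%N - bot f 0%N) + \sum_(i < M) absz (top f i.+1 - top f i) +
    \sum_(i < M) absz (bot f i.+1 - bot f i))%N.
  have h := absz_triangle (top f 0%N) (bot f 0%N) (bot f j).
  have {}h := leq_trans h (leq_add (leqnn _) (bb ord0 j)).
  apply: leq_trans (absz_triangle _ (top f 0%N) _) _.
  by apply: leq_trans (leq_add (tt i ord0) h) _; rewrite addnCA addnA.
have [i [->|->]] := cover v; have [j [->|->]] := cover w; rewrite -?botE -?topE.
- exact: leq_trans (bb i j) (leq_addl _ _).
- by rewrite absz_sym.
- exact: tbot.
- by apply: leq_trans (tt i j) _; rewrite addnAC leq_addl.
Qed.

Context (c : pclass) (A : pred {ffun V -> int}).

Definition good b t := is_ccpoly m b t && in_class c m b t.

Lemma good_ext b t b' t' : b =1 b' -> t =1 t' -> good b t = good b' t'.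
Proof.
by move=> hb ht; rewrite /good (is_ccpoly_ext _ hb ht) (in_class_ext _ _ hb ht).
Qed.

Context (build : ('I_m -> int) -> ('I_m -> int) -> {ffun V -> int}).
Hypothesis buildE : forall x y, good (extend x) (extend y) ->
  (forall i, build x y (beta i) = x i) /\ (forall i, build x y (tau i) = y i).
Hypothesis A_good : forall f, A f = good (bot f) (top f).
Hypothesis A_pinned : pinned A.

Lemma Fcoef_counting e : ((@Fcoef c m e)%:R : rat) = counting colweight A e.
Proof.
rewrite /counting /Fcoef; congr (_%:R); rewrite cardE.
set D := mdeg e; set P := [pred f | _].
pose x (h : {ffun 'I_m -> 'I_(2 * D).+1 * 'I_(2 * D).+1}) i : int := ((h i).1 : nat)%:Z - D%:Z.
pose y (h : {ffun 'I_m -> 'I_(2 * D).+1 * 'I_(2 * D).+1}) i : int := ((h i).2 : nat)%:Z - D%:Z.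
have PE h : (h \in P) = good (extend (x h)) (extend (y h)) &&
    (weight m (extend (x h)) (extend (y h)) == e).
  by rewrite inE /= /good -andbA.
have botK u v : good (extend u) (extend v) -> bot (build u v) =1 extend u.
  by move=> /buildE[h _]; apply: extend_eq.
have topK u v : good (extend u) (extend v) -> top (build u v) =1 extend v.
  by move=> /buildE[_ h]; apply: extend_eq.
rewrite -(size_map (fun h => build (x h) (y h))).
apply: perm_size; apply: uniq_perm.
- rewrite map_inj_in_uniq ?enum_uniq // => f g.
  rewrite !mem_enum !PE => /andP[/buildE[f1 f2] _] /andP[/buildE[g1 g2] _] E.
  apply/ffunP => i; rewrite [f i]surjective_pairing [g i]surjective_pairing.
  have := f1 i; have := f2 i; rewrite E g1 g2 /x /y => e2 e1.
  by congr pair; apply: val_inj => /=; move: e1 e2; lia.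
- exact: solutions_uniq.
move=> f; rewrite mem_solutions //; last exact: colweight_bound.
rewrite addm0; apply/mapP/andP => [[g]|[Af /eqP We]].
  rewrite mem_enum PE => /andP[gP We] ->.
  rewrite A_good (good_ext (botK _ _ gP) (topK _ _ gP)) gP.
  by rewrite /colweight (weight_ext m (botK _ _ gP) (topK _ _ gP)).
(* The pinned end bounds all values by [D], so encoding them with [inord] loses nothing. *)
have [v0 fv0] := A_pinned Af.
have fb v : (absz (f v) <= D)%N.
  by have := colweight_bound f v v0; rewrite We fv0 subr0.
have inordE (z : int) : (absz z <= D)%N ->
    ((inord (absz (z + D%:Z)) : 'I_(2 * D).+1) : nat)%:Z - D%:Z = z.
  by move=> zD; rewrite inordK; move: zD; lia.
pose g : {ffun 'I_m -> 'I_(2 * D).+1 * 'I_(2 * D).+1} :=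
  [ffun i => (inord (absz (f (beta i) + D%:Z)), inord (absz (f (tau i) + D%:Z)))].
have xg : x g =1 fun i => f (beta i) by move=> i; rewrite /x ffunE /= inordE.
have yg : y g =1 fun i => f (tau i) by move=> i; rewrite /y ffunE /= inordE.
have gP : good (extend (x g)) (extend (y g)).
  by rewrite (good_ext (extend_eq xg) (extend_eq yg)) -A_good.
exists g.
  rewrite mem_enum PE gP /=; apply/eqP; rewrite -We.
  exact: weight_ext (extend_eq xg) (extend_eq yg).
have [b1 t1] := buildE gP.
by apply/ffunP => v; have [i [->|->]] := cover v; rewrite ?b1 ?t1 ?xg ?yg.
Qed.
End Columns.

(** * The five classes *)

Section Classes.
Context (M : nat).
Local Notation m := M.+1.
Implicit Types (b t : nat -> int) (c : pclass).

(** Generating inequalities for each class, in the form of weak and strict relations between ends;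
    the other conditions on a polygon follow by transitivity. *)
Definition constraints c b t : Prop :=
  b 0%N = 0 /\
  match c with
  | Ferrers =>
      [/\ forall j, (j < M)%N -> b j.+1 = b j, b 0%N < t 0%N &
          forall j, (j < M)%N -> t j <= t j.+1]
  | Stack =>
      [/\ forall j, (j < M)%N -> b j.+1 <= b j, b 0%N < t 0%N &
          forall j, (j < M)%N -> t j <= t j.+1]
  | Staircase =>
      forall j, (j < M)%N -> [/\ b j <= b j.+1, t j <= t j.+1 & b j.+1 < t j]
  | Bargraph =>
      (forall j, (j < M)%N -> b j.+1 = b j) /\ (forall j, (j <= M)%N -> b j < t j)
  | ColumnConvex =>
      (forall j, (j <= M)%N -> b j < t j) /\
      (forall j, (j < M)%N -> b j.+1 < t j /\ b j < t j.+1)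
  end.

Lemma forall_step_eq0 (x : nat -> nat) (y z : nat -> int) :
  (forall i, x i = if (0 < i < m)%N then ppart (y i.-1 - z i) else 0%N) ->
  [forall i : 'I_m.+1, x i == 0%N] <-> (forall j, (j < M)%N -> y j <= z j.+1).
Proof.
move=> xE; split=> [/forallP h j jM|h].
  have jm : (j.+1 < m.+1)%N by rewrite !ltnS ltnW.
  have /eqP := h (Ordinal jm); rewrite xE /= ltnS jM /ppart.
  by case: ifP; move: (y j) (z j.+1); lia.
apply/forallP => -[[|j] /= jm]; rewrite xE //=; case: ifP => // jM.
have := h j jM; rewrite /ppart; case: ifP => //.
by move: (y j) (z j.+1); lia.
Qed.

(** The range stops before line [m], where [Nbot] counts the right edge. *)
Lemma forall_step_eq0' (x : nat -> nat) (y z : nat -> int) :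
  (forall i, (i < m)%N -> x i = if (0 < i < m)%N then ppart (y i.-1 - z i) else 0%N) ->
  [forall i : 'I_m, x i == 0%N] <-> (forall j, (j < M)%N -> y j <= z j.+1).
Proof.
move=> xE; split=> [/forallP h j jM|h].
  have jm : (j.+1 < m)%N by rewrite !ltnS.
  have /eqP := h (Ordinal jm); rewrite xE //= ltnS jM /ppart.
  by case: ifP; move: (y j) (z j.+1); lia.
apply/forallP => -[[|j] /= jm]; rewrite xE //=; case: ifP => // jM.
have := h j jM; rewrite /ppart; case: ifP => //.
by move: (y j) (z j.+1); lia.
Qed.

Lemma Stop_eq0 b t : [forall i : 'I_m.+1, Stop m b t i == 0%N] <->
  (forall j, (j < M)%N -> t j <= t j.+1).
Proof. exact: forall_step_eq0. Qed.

Lemma Sbot_eq0 b t : [forall i : 'I_m.+1, Sbot m b t i == 0%N] <->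
  (forall j, (j < M)%N -> b j <= b j.+1).
Proof. exact: forall_step_eq0. Qed.

Lemma Sbot_eq0' b t : [forall i : 'I_m, Sbot m b t i == 0%N] <->
  (forall j, (j < M)%N -> b j <= b j.+1).
Proof. exact: forall_step_eq0'. Qed.

Lemma Nbot_eq0 b t : [forall i : 'I_m, Nbot m b t i == 0%N] <->
  (forall j, (j < M)%N -> b j.+1 <= b j).
Proof.
(* North steps of [b] are south steps of [- b], the form treated by [forall_step_eq0']. *)
have -> : (forall j, (j < M)%N -> b j.+1 <= b j) <->
          (forall j, (j < M)%N -> - b j <= - b j.+1).
  by split=> h j jM; have := h j jM; rewrite lerN2.
apply: (@forall_step_eq0' _ (fun i => - b i) (fun i => - b i)) => i im.
by rewrite /Nbot opprK [- _ + _]addrC (ltn_eqF im).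
Qed.

Lemma ccpolyP b t : is_ccpoly m b t <->
  [/\ b 0%N = 0, forall j, (j <= M)%N -> b j < t j &
      forall j, (j < M)%N -> b j.+1 < t j /\ b j < t j.+1].
Proof.
split=> [/and3P[/eqP b0 /forallP h1 /forallP h2]|[b0 h1 h2]].
  split=> // j jM; first exact: (h1 (Ordinal (jM : (j < m)%N))).
  have jm : (j < m)%N by rewrite ltnS ltnW.
  by have := h2 (Ordinal jm); rewrite /= ltnS jM => /andP.
apply/and3P; split; first exact/eqP.
  by apply/forallP => j; apply: h1; rewrite -ltnS.
by apply/forallP => j; apply/implyP; rewrite ltnS => /h2/andP.
Qed.

Lemma le_steps (x : nat -> int) : (forall j, (j < M)%N -> x j <= x j.+1) ->
  forall j, (j <= M)%N -> x 0%N <= x j.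
Proof.
move=> h; elim=> // j IH jM.
by apply: le_trans (IH (ltnW jM)) (h j jM).
Qed.

Lemma ge_steps (x : nat -> int) : (forall j, (j < M)%N -> x j.+1 <= x j) ->
  forall j, (j <= M)%N -> x j <= x 0%N.
Proof.
move=> h; elim=> // j IH jM.
by apply: le_trans (h j jM) (IH (ltnW jM)).
Qed.

(** For staircases [b j < t j] comes from the strict inequality with a neighbouring column; the
    first column thus requires a second one. *)
Lemma constraints_good c b t : (c = Staircase -> (0 < M)%N) ->
  constraints c b t <-> good c (M := M) b t.
Proof.
move=> hM; split.
  move=> [b0 h]; apply/andP; split.
    apply/ccpolyP; case: c hM h => hM => [[h1 h2 h3]|[h1 h2 h3]|h|[h1 h2]|[h1 h2]].
    - have h1' j : (j < M)%N -> b j.+1 <= b j by move=> /h1 ->.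
      have p j k : (j <= M)%N -> (k <= M)%N -> b j < t k.
        move=> jM kM; apply: le_lt_trans (ge_steps h1' jM) _.
        exact: lt_le_trans h2 (le_steps h3 kM).
      by split=> // j jM; [apply: p|split; apply: p; rewrite // ltnW].
    - have p j k : (j <= M)%N -> (k <= M)%N -> b j < t k.
        move=> jM kM; apply: le_lt_trans (ge_steps h1 jM) _.
        exact: lt_le_trans h2 (le_steps h3 kM).
      by split=> // j jM; [apply: p|split; apply: p; rewrite // ltnW].
    - split=> // [[|j] jM|j jM].
      + by have [h1 h2 h3] := h 0%N (hM erefl); apply: le_lt_trans h1 h3.
      + by have [h1 h2 h3] := h j jM; apply: lt_le_trans h3 h2.
      + have [h1 h2 h3] := h j jM; split=> //.
        by apply: le_lt_trans h1 (lt_le_trans h3 h2).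
    - split=> // j jM; split; first by rewrite h1 // h2 // ltnW.
      by rewrite -h1 // h2.
    - by [].
  case: c hM h => hM => [[h1 h2 h3]|[h1 h2 h3]|h|[h1 h2]|[h1 h2]] //=.
  - apply/and3P; split; first exact/Stop_eq0.
      by apply/Nbot_eq0 => j /h1 ->.
    by apply/Sbot_eq0' => j /h1 ->.
  - by apply/andP; split; [exact/Stop_eq0|exact/Nbot_eq0].
  - by apply/andP; split; [apply/Stop_eq0|apply/Sbot_eq0] => j /h[].
  - apply/andP; split; first by apply/Nbot_eq0 => j /h1 ->.
    by apply/Sbot_eq0' => j /h1 ->.
move=> /andP[/ccpolyP[b0 h1 h2] H].
case: c hM H => hM /= H; split=> //.
- move: H => /and3P[/Stop_eq0 a1 /Nbot_eq0 a2 /Sbot_eq0' a3].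
  split=> // [j jM|]; last exact: h1.
  by apply/eqP; rewrite eq_le a2 ?a3.
- by move: H => /andP[/Stop_eq0 a1 /Nbot_eq0 a2]; split=> //; apply: h1.
- move: H => /andP[/Stop_eq0 a1 /Sbot_eq0 a2] j jM.
  by split; [exact: a2|exact: a1|case: (h2 j jM)].
- move: H => /andP[/Nbot_eq0 a2 /Sbot_eq0' a3].
  by split=> // j jM; apply/eqP; rewrite eq_le a2 ?a3.
Qed.
End Classes.

(** * Translations of the column ends and the factor C_m *)

Section Shift.
Context (M : nat).
Local Notation m := M.+1.
Implicit Types (b t : nat -> int) (c : pclass).

(** With [top_shift], starts from 0 at the first bottom, rises by one along each weak inequality of
    the class and falls by one along each strict one. *)
Definition bot_shift c (j : nat) : int :=
  match c with
  | Stack => - j%:Z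
  | Staircase => j%:Z
  | _ => 0
  end.

Definition top_shift c (j : nat) : int :=
  match c with
  | Ferrers | Stack => j%:Z - 1
  | Staircase => j%:Z
  | Bargraph | ColumnConvex => -1
  end.

Local Notation U k i := U_(@vid m (k%R : 'I_4) i)%MM.
Local Notation "'inner' k" := (\big[mnm_add/0%MM]_(i < m.+1 | (0 < i < m)%N) U k i)
  (at level 10, k at level 8).

(* Moving the ends by [bot_shift] and [top_shift] multiplies weights by
   [X^gained / X^lost]. *)
Definition lost c : 'X_{1..nvars m} :=
  match c with
  | Ferrers => (U 0 ord0 + U 2 ord_max *+ 2)%MM
  | Stack => (U 0 ord0 + U 2 ord_max *+ 3)%MM
  | Staircase => 0%MM
  | Bargraph | ColumnConvex => (U 0 ord0 + U 2 ord_max)%MM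
  end.

Definition gained c : 'X_{1..nvars m} :=
  match c with
  | Ferrers => (inner 0 + U 2 ord_max *+ m)%MM
  | Stack => (inner 0 + inner 3 + U 2 ord_max *+ (2 * m))%MM
  | Staircase => (inner 2 + inner 0)%MM
  | Bargraph | ColumnConvex => 0%MM
  end.

Lemma vidE (k k' : 'I_4) (i i' : 'I_m.+1) :
  (vid k i == vid k' i') = (k == k' :> nat) && (i == i' :> nat).
Proof. exact: vid_eq. Qed.

Lemma innerE (k k' : 'I_4) (i' : 'I_m.+1) :
  (inner k) (vid k' i') = nat_of_bool ((k == k' :> nat) && (0 < i' < m)%N).
Proof.
rewrite mnm_sumE; under eq_bigr => i _ do rewrite mnm1E vidE.
have [im|im] := boolP (0 < i' < m)%N.
  rewrite (bigD1 i') //= eqxx andbT big1 ?addn0 // => i /andP[_ ne].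
  by rewrite (negPf (ne : (i != i' :> nat))) andbF.
rewrite andbF big1 // => i im'; case: eqP => // _; case: eqP => //= ii.
by move: im; rewrite -ii im'.
Qed.

Lemma steps_inner b t j : (j < M)%N ->
  [/\ Ntop m b t j.+1 = ppart (t j.+1 - t j), Stop m b t j.+1 = ppart (t j - t j.+1),
      Nbot m b t j.+1 = ppart (b j.+1 - b j) & Sbot m b t j.+1 = ppart (b j - b j.+1)].
Proof. by move=> jM; rewrite /Ntop /Stop /Nbot /Sbot /= !ltnS jM. Qed.

Lemma steps_last b t : [/\ Ntop m b t m = 0%N, Stop m b t m = 0%N,
  Nbot m b t m = absz (t M - b M) & Sbot m b t m = 0%N].
Proof. by rewrite /Ntop /Stop /Nbot /Sbot /= ltnn eqxx. Qed.

Lemma line_cases (i : 'I_m.+1) :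
  [\/ i = 0%N :> nat, exists2 j, (j < M)%N & i = j.+1 :> nat | i = m :> nat].
Proof.
case: i => [[|j] /= im]; first exact: Or31.
move: im; rewrite !ltnS leq_eqVlt => /orP[/eqP ->|jM]; first exact: Or33.
by apply: Or32; exists j.
Qed.

Lemma weight_shift c b t b' t' : (c = Staircase -> (0 < M)%N) ->
  constraints M c b t ->
  (forall j, (j <= M)%N -> b' j = b j + bot_shift c j) ->
  (forall j, (j <= M)%N -> t' j = t j + top_shift c j) ->
  (weight m b' t' + lost c = weight m b t + gained c)%MM.
Proof.
move=> hM hc hb ht; have /andP[/ccpolyP[_ pos _] _] := (constraints_good _ _ hM).1 hc.
apply: weightP => i; have [i0|[j jM ij]|im] := line_cases i.
- have := pos 0%N (leq0n M); rewrite i0 /Ntop /Stop /Nbot /Sbot /= hb // ht //.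
  case: c {hM hc hb ht}; rewrite /lost /gained !mnmDE ?mulmnE ?mnm0E ?mnm1E;
    rewrite ?mnmDE ?innerE ?vidE i0 /=; move: (b 0%N) (t 0%N) => x y; split; lia.
(* Where the shift varies along a path, the class fixes the sign of the steps, which then grow by
   one. For bar-graphs and column-convex polygons it is constant on each path. *)
- have : match c with
    | Ferrers => b j.+1 = b j /\ t j <= t j.+1
    | Stack => b j.+1 <= b j /\ t j <= t j.+1
    | Staircase => b j <= b j.+1 /\ t j <= t j.+1
    | _ => True
    end.
    by case: c {hM hb ht} hc => -[_] // => [[h1 _ h2]|[h1 _ h2]|h];
      [rewrite h1 // h2|rewrite h1 // h2|have [] := h j jM].
  rewrite ij; have [-> -> -> ->] := steps_inner b' t' jM.
  have [-> -> -> ->] := steps_inner b t jM.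
  rewrite !hb ?(ltnW jM) // !ht ?(ltnW jM) //.
  case: c {hM hc hb ht}; rewrite /lost /gained !mnmDE ?mulmnE ?mnm0E ?mnm1E;
    rewrite ?mnmDE ?innerE ?vidE ij /= ?ltnS ?jM ?eqSS ?(gtn_eqF jM) /ppart;
    move: (b j) (t j) (b j.+1) (t j.+1) => x y x' y'; split;
    do ?[case: ifP => ?]; lia.
- have := pos M (leqnn M); rewrite im.
  have [-> -> -> ->] := steps_last b' t'; have [-> -> -> ->] := steps_last b t.
  rewrite hb // ht //.
  case: c {hM hc hb ht}; rewrite /lost /gained !mnmDE ?mulmnE ?mnm0E ?mnm1E;
    rewrite ?mnmDE ?innerE ?vidE im /= ?ltnn ?eqxx ?andbF;
    move: (b M) (t M) => x y; split; lia.
Qed.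

Lemma rf_inner (k : 'I_4) :
  rf 'X_[inner k] = \prod_(i < m.+1 | (0 < i < m)%N) rvar (vid k i).
Proof.
exact: (big_morph (fun x : 'X_{1..nvars m} => rf 'X_[x]) rf_monomD rf_monom0).
Qed.

Lemma ferrers_factor (K : fieldType) (s p y q u : K) :
  y != 0 -> s * p / y * q * (y * u) = s * (q * (p * u)).
Proof. by move=> y0; field. Qed.

Lemma stack_factor (K : fieldType) (p y q r u : K) :
  y != 0 -> - (p / y * (q * r)) * (y * u) = -1 * (q * r * (p * u)).
Proof. by move=> y0; field. Qed.

(** Handles the exponents [m - 2] and [2m - 3], negative for [m = 1]; this is why [lost] keeps the
    powers 2 and 3 of the last variable. *)
Lemma expfzB (K : fieldType) (u : K) (k l : nat) :
  u != 0 -> u ^ (k%:Z - l%:Z) * u ^+ l = u ^+ k.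
Proof. by move=> u0; rewrite -[u ^+ l]/(u ^ l%:Z) -expfzDr // subrK. Qed.

Lemma Cfactor_shift c :
  Cfactor c m * rf 'X_[lost c] =
  (match c with Ferrers | Bargraph => (-1) ^+ m | _ => -1 end) * rf 'X_[gained c].
Proof.
have y0 : ybar (ord0 : 'I_m.+1) != 0 by apply: rf_monom_neq0.
have u0 : yund (ord_max : 'I_m.+1) != 0 by apply: rf_monom_neq0.
case: c; rewrite /Cfactor /lost /gained ?rf_monomD ?rf_monomMn ?rf_monom0 ?rf_inner ?mulr1.
- rewrite !rf_var -/(ybar _) -/(yund _) -(expfzB m 2 u0).
  exact: (ferrers_factor _ _ _ _ y0).
- rewrite !rf_var -/(ybar _) -/(yund _) -(expfzB (2 * m) 3 u0) PoszM big_split.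
  exact: (stack_factor _ _ _ _ y0).
- by rewrite mulN1r big_split.
- rewrite !rf_var -/(ybar _) -/(yund _).
  exact: (mulfVK (mulf_neq0 y0 u0)).
- rewrite !rf_var -/(ybar _) -/(yund _) mulNr div1r.
  by rewrite (mulVf (mulf_neq0 y0 u0)).
Qed.
End Shift.

(** * Labelled relations for the classes *)

Definition reciprocity_claim c m :=
  exists (P Q : {mpoly rat[nvars m]}),
    Q@_0%MM != 0 /\
    (forall e : 'X_{1..nvars m},
        series_mul_coef Q (fun e' => (@Fcoef c m e')%:R) e = P@_e) /\
    rf_inv P / rf_inv Q = Cfactor c m * (rf P / rf Q).

Lemma reciprocity_of_labelling M c (V : finType) (beta tau : 'I_M.+1 -> V)
    (build : ('I_M.+1 -> int) -> ('I_M.+1 -> int) -> {ffun V -> int})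
    (r : rel V) (om : V -> int) (delta : {ffun V -> int}) :
  (c = Staircase -> (0 < M)%N) ->
  (forall v, exists i, v = beta i \/ v = tau i) ->
  (forall x y, constraints M c (extend x) (extend y) ->
    (forall i, build x y (beta i) = x i) /\ (forall i, build x y (tau i) = y i)) ->
  injective om ->
  (forall f, normalized r om (beta ord0) f <->
             constraints M c (bot beta f) (top tau f)) ->
  (forall i, delta (beta i) = bot_shift c i) ->
  (forall i, delta (tau i) = top_shift c i) ->
  (forall p q, r p q -> delta q - delta p = if om p < om q then 1 else -1) ->
  (-1) ^+ #|V|.-1 =
    match c with Ferrers | Bargraph => (-1) ^+ M.+1 | _ => -1 end
    :> ratfun (nvars M.+1) ->
  reciprocity_claim c M.+1.
Proof.
move=> hM cover buildE om_inj AP db dt dr sgn.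
pose W := @colweight M V beta tau.
have d0 : delta (beta ord0) = 0 by rewrite db; case: (c).
have shiftW f : normalized r om (beta ord0) f ->
    (W (f + delta)%R + lost M c = W f + gained M c)%MM.
  move=> /AP fc; apply: weight_shift hM fc _ _ => j jM.
    by rewrite botD (botE _ delta (Ordinal (jM : (j < M.+1)%N))) db.
  by rewrite topD (topE _ delta (Ordinal (jM : (j < M.+1)%N))) dt.
have [P [Q [Q0 hP E]]] := shifted_reciprocity (@colweightD M V beta tau)
  (colweight_bound cover) om_inj d0 dr shiftW.
exists P, Q; split=> //; split=> [e|].
  rewrite -hP; apply: eq_bigr => d _; congr (_ * _).
  apply: (Fcoef_counting cover (build := build)).
  - by move=> x y /(constraints_good _ _ hM) /buildE.
  - by move=> f; apply/idP/idP => [/AP /(constraints_good _ _ hM)|/(constraints_good _ _ hM) /AP].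
  - exact: normalized_pinned.
(* Both sides are compared after multiplication by the lost monomial, which is nonzero. *)
apply: (mulIf (rf_monom_neq0 (lost M c))).
by rewrite E sgn [RHS]mulrAC Cfactor_shift.
Qed.

(* Stacks, staircases and column-convex polygons: all ends move freely. *)
Section TwoPaths.
Context (M : nat).
Local Notation V := (bool * 'I_M.+1)%type.

(** In a pair, [true] marks the top and [false] the bottom of the column. *)
Definition path_rel c (p q : V) : bool :=
  let i : nat := p.2 in let j : nat := q.2 in
  match p.1, q.1 with
  | false, true =>
      match c with
      | Stack => (i == 0%N) && (j == 0%N)
      | Staircase => i == j.+1
      | _ => [|| i == j, i == j.+1 | j == i.+1]
      end
  | true, true => match c with Stack | Staircase => j == i.+1 | _ => false end
  | false, false =>
      match c with Stack => i == j.+1 | Staircase => j == i.+1 | _ => false end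
  | true, false => false
  end.

(* Strict inequalities are those along which the label decreases. *)
Definition path_label c (p : V) : int :=
  let i : nat := p.2 in
  if p.1 then i%:Z else if c is Stack then (2 * M.+1)%:Z - i%:Z else (M.+1 + i)%:Z.

Definition path_build (x y : 'I_M.+1 -> int) : {ffun V -> int} :=
  [ffun p => if p.1 then y p.2 else x p.2].

Definition path_shift c : {ffun V -> int} :=
  [ffun p : V => if p.1 then top_shift c p.2 else bot_shift c p.2].

Lemma path_label_inj c : injective (path_label c).
Proof.
move=> [[] i] [[] j]; rewrite /path_label /=; have := ltn_ord i; have := ltn_ord j;
  move=> hj hi E.
- by congr pair; apply: val_inj; move: E => /= [].
- by exfalso; move: E; case: c; lia.
- by exfalso; move: E; case: c; lia.
- by congr pair; apply: val_inj => /=; move: E; case: c; lia.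
Qed.

(** Every bottom has a larger label than every top, and along either path labels increase in the
    direction of the relation; so exactly the relations from a bottom to a top are strict. *)
Lemma path_relP c p q x y : path_rel c p q ->
  lexlt x (path_label c p) y (path_label c q) =
    if ~~ p.1 && q.1 then x < y else x <= y.
Proof.
case: p q => [[] i] [[] j]; have := ltn_ord i; have := ltn_ord j;
  case: c; rewrite /path_rel /path_label /lexlt /=; lia.
Qed.

Lemma path_shift_rel c p q : c = Stack \/ c = Staircase \/ c = ColumnConvex ->
  path_rel c p q -> path_shift c q - path_shift c p =
    if path_label c p < path_label c q then 1 else -1.
Proof.
move=> [|[|]] ->; case: p q => [[] i] [[] j]; have := ltn_ord i; have := ltn_ord j;
  rewrite !ffunE /path_rel /path_label /bot_shift /top_shift /=; case: ltP; lia.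
Qed.

Lemma path_normalized c f : c = Stack \/ c = Staircase \/ c = ColumnConvex ->
  normalized (path_rel c) (path_label c) (false, ord0) f <->
  constraints M c (bot (pair false) f) (top (pair true) f).
Proof.
pose o j (jM : (j <= M)%N) := Ordinal (jM : (j < M.+1)%N).
have bo j (jM : (j <= M)%N) : bot (pair false) f j = f (false, o j jM).
  exact: (botE _ f (o j jM)).
have to j (jM : (j <= M)%N) : top (pair true) f j = f (true, o j jM).
  exact: (topE _ f (o j jM)).
have b0 : bot (pair false) f 0 = f (false, ord0) by exact: (botE _ f ord0).
move=> hc; split=> [/normalizedP[f0 fr]|[f0 h]].
  have {}fr p q : path_rel c p q -> if ~~ p.1 && q.1 then f p < f q else f p <= f q.
    by move=> pq; have := fr _ _ pq; rewrite path_relP.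
  split; first by rewrite b0.
  case: hc fr => [|[|]] -> fr.
  - split=> [j jM||j jM].
    + rewrite (bo _ jM) (bo _ (ltnW jM)).
      by apply: (fr (false, o _ jM) (false, o _ (ltnW jM))); rewrite /path_rel /= eqxx.
    + rewrite (bo _ (leq0n M)) (to _ (leq0n M)).
      exact: (fr (false, o _ (leq0n M)) (true, o _ (leq0n M))).
    + rewrite (to _ jM) (to _ (ltnW jM)).
      by apply: (fr (true, o _ (ltnW jM)) (true, o _ jM)); rewrite /path_rel /= eqxx.
  - move=> j jM; rewrite (to _ jM) (to _ (ltnW jM)) (bo _ jM) (bo _ (ltnW jM)); split.
    + by apply: (fr (false, o _ (ltnW jM)) (false, o _ jM)); rewrite /path_rel /= eqxx.
    + by apply: (fr (true, o _ (ltnW jM)) (true, o _ jM)); rewrite /path_rel /= eqxx.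
    + by apply: (fr (false, o _ jM) (true, o _ (ltnW jM))); rewrite /path_rel /= eqxx.
  - split=> j jM.
      rewrite (to _ jM) (bo _ jM).
      by apply: (fr (false, o _ jM) (true, o _ jM)); rewrite /path_rel /= eqxx.
    rewrite (to _ jM) (to _ (ltnW jM)) (bo _ jM) (bo _ (ltnW jM)); split.
    + apply: (fr (false, o _ jM) (true, o _ (ltnW jM))).
      by rewrite /path_rel /= eqxx orbT.
    + apply: (fr (false, o _ (ltnW jM)) (true, o _ jM)).
      by rewrite /path_rel /= eqxx !orbT.
apply/normalizedP; split=> [|p q pq]; first by rewrite -b0.
rewrite path_relP //.
have bE (i : 'I_M.+1) : f (false, i) = bot (pair false) f i by rewrite botE.
have tE (i : 'I_M.+1) : f (true, i) = top (pair true) f i by rewrite topE.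
case: p q pq => [[] i] [[] j] //=; rewrite ?bE ?tE;
  have := ltn_ord i; have := ltn_ord j; rewrite !ltnS => jM iM;
  case: hc h => [|[|]] ->; rewrite /path_rel //=.
- by move=> [_ _ h] /eqP ji; rewrite ji in jM *; apply: h.
- by move=> h /eqP ji; rewrite ji in jM *; have [] := h _ jM.
- by move=> [_ h _] /andP[/eqP -> /eqP ->].
- by move=> h /eqP ij; rewrite ij in iM *; have [] := h _ iM.
- move=> [h1 h2] /or3P[] /eqP E.
  + by rewrite E h1.
  + by rewrite E in iM *; have [] := h2 _ iM.
  + by rewrite E in jM *; have [] := h2 _ jM.
- by move=> [h _ _] /eqP ij; rewrite ij in iM *; apply: h.
- by move=> h /eqP ji; rewrite ji in jM *; have [] := h _ jM.
Qed.

Lemma path_reciprocity c : c = Stack \/ c = Staircase \/ c = ColumnConvex ->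
  (c = Staircase -> (0 < M)%N) -> reciprocity_claim c M.+1.
Proof.
move=> hc hM; apply: (reciprocity_of_labelling (beta := pair false) (tau := pair true)
  (build := path_build) (r := path_rel c) (om := path_label c)
  (delta := path_shift c) hM).
- by move=> [[] i]; exists i; [right|left].
- by move=> x y _; split=> i; rewrite ffunE.
- exact: path_label_inj.
- by move=> f; apply: path_normalized.
- by move=> i; rewrite ffunE.
- by move=> i; rewrite ffunE.
- by move=> p q; apply: path_shift_rel.
(* There are [2m] ends, and [2m - 1] is odd. *)
- rewrite card_prod card_bool card_ord mulnS /= -signr_odd oddS oddM /=.
  by case: hc => [|[|]] ->; rewrite expr1.
Qed.
End TwoPaths.

(* Ferrers diagrams and bar-graphs: [None] stands for the common bottom. *)
Section TopPath.
Context (M : nat).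
Local Notation V := (option 'I_M.+1).

Definition base (_ : 'I_M.+1) : V := None.

Definition top_rel c (p q : V) : bool :=
  match p, q with
  | None, Some j => if c is Ferrers then j == 0%N :> nat else true
  | Some i, Some j => if c is Ferrers then j == i.+1 :> nat else false
  | _, None => false
  end.

(** The base has the largest label, making its relations to the tops strict; labels increase along
    the tops, whose relations are weak. *)
Definition top_label (p : V) : int := if p is Some i then (i : nat)%:Z else M.+1%:Z.

Definition top_build (x y : 'I_M.+1 -> int) : {ffun V -> int} :=
  [ffun p => if p is Some i then y i else x ord0].

Definition top_delta c : {ffun V -> int} :=
  [ffun p : V => oapp (fun i : 'I_M.+1 => top_shift c i) 0 p].

Lemma top_label_inj : injective top_label.
Proof.
move=> [i|] [j|] //=; rewrite /top_label.
- by move=> [E]; congr Some; apply: val_inj.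
- by have := ltn_ord i; lia.
- by have := ltn_ord j; lia.
Qed.

Lemma top_relP c p q x y : top_rel c p q ->
  lexlt x (top_label p) y (top_label q) = if p is None then x < y else x <= y.
Proof.
case: p q => [i|] [j|] //; try have := ltn_ord i; have := ltn_ord j;
  case: c; rewrite /top_rel /top_label /lexlt //=; lia.
Qed.

Lemma top_delta_rel c p q : c = Ferrers \/ c = Bargraph ->
  top_rel c p q -> top_delta c q - top_delta c p =
    if top_label p < top_label q then 1 else -1.
Proof.
move=> [|] ->; case: p q => [i|] [j|] //; try have := ltn_ord i; have := ltn_ord j;
  rewrite !ffunE /top_rel /top_label /top_shift //=; case: ltP; lia.
Qed.

Lemma top_normalized c f : c = Ferrers \/ c = Bargraph ->
  normalized (top_rel c) top_label None f <->
  constraints M c (bot base f) (top Some f).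
Proof.
have bE j : (j <= M)%N -> bot base f j = f None.
  by move=> jM; apply: (botE _ f (Ordinal (jM : (j < M.+1)%N))).
have tE (i : 'I_M.+1) : f (Some i) = top Some f i by rewrite topE.
pose o j (jM : (j <= M)%N) := Ordinal (jM : (j < M.+1)%N).
have to j (jM : (j <= M)%N) : top Some f j = f (Some (o j jM)).
  exact: (topE _ f (o j jM)).
move=> hc; split=> [/normalizedP[f0 fr]|[f0 h]].
  have {}fr p q : top_rel c p q -> if p is None then f p < f q else f p <= f q.
    by move=> pq; have := fr _ _ pq; rewrite (top_relP _ _ pq).
  split; first by rewrite bE.
  case: hc fr => [|] -> fr.
  - split=> [j jM||j jM].
    + by rewrite !bE // ltnW.
    + by rewrite bE // (to _ (leq0n M)); apply: (fr None).
    + rewrite (to _ jM) (to _ (ltnW jM)).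
      by apply: (fr (Some (o _ (ltnW jM))) (Some (o _ jM))); rewrite /top_rel /= eqxx.
  - split=> j jM; first by rewrite !bE // ltnW.
    by rewrite bE // (to _ jM); apply: (fr None).
apply/normalizedP; split=> [|p q pq]; first by rewrite -(bE 0%N).
rewrite (top_relP _ _ pq).
case: p q pq => [i|] [j|] //=; rewrite ?tE;
  have := ltn_ord j; rewrite ltnS => jM;
  case: hc h => [|] -> //=.
- by move=> [_ _ h] /eqP ji; rewrite ji in jM *; apply: h.
- by move=> [_ h _] /eqP ->; rewrite -(bE 0%N).
- by move=> [_ h] _; rewrite -(bE j) // h.
Qed.

Lemma top_reciprocity c : c = Ferrers \/ c = Bargraph -> reciprocity_claim c M.+1.
Proof.
move=> hc; apply: (reciprocity_of_labelling (beta := base) (tau := Some)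
  (build := top_build) (r := top_rel c) (om := top_label) (delta := top_delta c)).
- by case: hc => ->.
- by move=> [i|]; [exists i; right|exists ord0; left].
- move=> x y [_ h]; split=> i; rewrite ffunE //.
  (* [top_build] keeps only the first bottom; the constraints make all bottoms equal to it. *)
  have {}h j : (j < M)%N -> extend x j.+1 = extend x j.
    by case: hc h => -> [h *]; apply: h.
  rewrite -!extendE; have := ltn_ord i; rewrite ltnS.
  elim: (i : nat) => [//|j IH] jM.
  by rewrite h // -IH // ltnW.
- exact: top_label_inj.
- by move=> f; apply: top_normalized.
- by move=> i; rewrite ffunE; case: hc => ->.
- by move=> i; rewrite ffunE.
- by move=> p q; apply: top_delta_rel.
(* There are [m + 1] ends, whence the sign [(-1)^m]. *)
- by rewrite card_option card_ord /=; case: hc => ->.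
Qed.
End TopPath.

Theorem theorem1 (c : pclass) (m : nat) :
  (1 <= m)%N -> (c = Staircase -> (2 <= m)%N) ->
  exists (P Q : {mpoly rat[nvars m]}),
    Q@_0%MM != 0 /\
    (forall e : 'X_{1..nvars m},
        series_mul_coef Q (fun e' => (@Fcoef c m e')%:R) e = P@_e) /\
    rf_inv P / rf_inv Q = Cfactor c m * (rf P / rf Q).
Proof.
case: m => // M _ hM; rewrite -/(reciprocity_claim c M.+1).
case: c hM => hM.
- by apply: top_reciprocity; left.
- by apply: path_reciprocity => //; left.
- by apply: path_reciprocity hM; right; left.
- by apply: top_reciprocity; right.
- by apply: path_reciprocity => //; right; right.
Qed.
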